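(* Let $k \in \{0,1,2,3\}$ and $c \geq k+1$. If $X \subset \mathbb{P}^{n+c}$ is an $n$-dimensional nondegenerate irreducible projective variety with $a_2(X) = \binom{c+1}{2} - k$, then $X$ is the only nondegenerate irreducible component of $\mathsf{Q}(X)$ of dimension $\geq n$.
   Context: Work over an algebraically closed field of characteristic zero. For a closed subscheme $Z \subset \mathbb{P}^r$, $a_2(Z) := h^0(\mathbb{P}^r, \mathcal{I}_Z(2))$. $\mathsf{Q}(X)$ denotes the base locus $\operatorname{Bs}(|\mathcal{I}_X(2)|)$, i.e. the common zero set in $\mathbb{P}^{n+c}$ of all quadratic forms vanishing on $X$ (the degree-2 part $I(X)_2$ of the homogeneous ideal). Nondegenerate means not contained in any hyperplane. *)

(* Defs.v *)
From HB Require Import structures.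
From mathcomp Require Import all_boot all_order all_algebra.
From mathcomp Require Import mpoly.
Set Implicit Arguments. Unset Strict Implicit. Unset Printing Implicit Defensive.
Import GRing.Theory.
Local Open Scope ring_scope.

(* Projective space P^N over K (N = m - 1) is modelled through the affine cone:
   a point of P^N is represented by any nonzero vector v : 'I_m -> K, and all
   subsets below are sets of such representatives (closed under scaling when
   they are Zariski closed). *)
Definition pset (K : closedFieldType) (m : nat) := ('I_m -> K) -> Prop.

Definition nonzero_vec (K : closedFieldType) (m : nat) (v : 'I_m -> K) :=
  exists i, v i != 0.

Definition psubset (K : closedFieldType) (m : nat) (A B : pset K m) := forall v, A v -> B v.
Definition pseteq (K : closedFieldType) (m : nat) (A B : pset K m) := forall v, A v <-> B v.

Definition homogeneous (K : closedFieldType) (m : nat) (p : {mpoly K[m]}) := exists d : nat, p \is d.-homog.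

Definition zero_locus (K : closedFieldType) (m : nat) (S : {mpoly K[m]} -> Prop) : pset K m :=
  fun v => nonzero_vec v /\ forall p, S p -> p.@[v] = 0.

Definition zclosed (K : closedFieldType) (m : nat) (Z : pset K m) :=
  exists S : {mpoly K[m]} -> Prop,
    (forall p, S p -> homogeneous p) /\ pseteq Z (zero_locus S).

Definition proj_irreducible (K : closedFieldType) (m : nat) (Z : pset K m) :=
  [/\ zclosed Z, exists v, Z v &
      forall Z1 Z2 : pset K m, zclosed Z1 -> zclosed Z2 ->
        psubset Z (fun v => Z1 v \/ Z2 v) -> psubset Z Z1 \/ psubset Z Z2].

Definition psubsetneq (K : closedFieldType) (m : nat) (A B : pset K m) := psubset A B /\ ~ psubset B A.

Definition dim_ge (K : closedFieldType) (m : nat) (Z : pset K m) (d : nat) :=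
  exists C : nat -> pset K m,
    [/\ forall i, (i <= d)%N -> proj_irreducible (C i),
        forall i, (i < d)%N -> psubsetneq (C i) (C i.+1) &
        psubset (C d) Z].

Definition dim_eq (K : closedFieldType) (m : nat) (Z : pset K m) (d : nat) := dim_ge Z d /\ ~ dim_ge Z d.+1.

Definition proj_nondegenerate (K : closedFieldType) (m : nat) (Z : pset K m) :=
  forall l : {mpoly K[m]}, l \is 1.-homog -> l != 0 ->
    ~ psubset Z (zero_locus (fun p => p = l)).

Definition quadrics_on (K : closedFieldType) (m : nat) (Z : pset K m) (q : {mpoly K[m]}) :=
  q \is 2.-homog /\ forall v, Z v -> q.@[v] = 0.

Definition lin_indep (K : closedFieldType) (m : nat) (b : nat) (qs : 'I_b -> {mpoly K[m]}) :=
  forall a : 'I_b -> K, \sum_(i < b) a i *: qs i = 0 -> forall i, a i = 0.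

Definition a2_eq (K : closedFieldType) (m : nat) (Z : pset K m) (b : nat) :=
  (exists qs : 'I_b -> {mpoly K[m]},
      (forall i, quadrics_on Z (qs i)) /\ lin_indep qs) /\
  (forall qs : 'I_b.+1 -> {mpoly K[m]},
      (forall i, quadrics_on Z (qs i)) -> ~ lin_indep qs).

Definition Qlocus (K : closedFieldType) (m : nat) (Z : pset K m) : pset K m := zero_locus (quadrics_on Z).

Definition irr_component (K : closedFieldType) (m : nat) (W Y : pset K m) :=
  [/\ proj_irreducible Y, psubset Y W &
      forall Y', proj_irreducible Y' -> psubset Y Y' -> psubset Y' W -> pseteq Y' Y].

(* Main.v *)
Require Import Defs.
From HB Require Import structures.
From mathcomp Require Import all_boot all_order all_algebra.
From mathcomp Require Import mpoly.
From mathcomp Require Import closed_field ring zify.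
From Stdlib Require Import Classical.
Set Implicit Arguments. Unset Strict Implicit. Unset Printing Implicit Defensive.
Import GRing.Theory.
Local Open Scope ring_scope.

(** Suppose [Y <> X] is another nondegenerate component of dimension at least
[n] of the base locus, so that all quadrics through [X] contain [Y]. Restrict
them to a general linear subspace [L] of codimension [n]. The restriction is
injective, and [L] meets both [X] and [Y] in sets spanning [L]: it can be
spanned by general points [x_0, .., x_c] of [X], and also by general points of
[Y], because projecting [X] or [Y] from [c] general points is dominant onto
[P^n]. In the basis [x_i] the restricted quadrics are symmetric matrices with
zero diagonal, a space of dimension ['C(c + 1, 2)], and the points of [Y] in [L]
impose further conditions. If no point of [Y] in [L] lies on a proper face of
the simplex [x_0, .., x_c], a basis of [L] made of points of [Y] imposes at
least [c > k] conditions. Otherwise, by genericity, some [2 <= s <= c] has the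
property that every face with [s] vertices contains a point of [Y] in its
relative interior, and a look at the supports of these points gives at least
four conditions, or three if [s = c] and [k < 3]. In both cases more than [k]
conditions contradict [a_2 = 'C(c + 1, 2) - k]. The same restriction argument,
without the points of [Y], shows that [X] is a component.

A property of points is called generic when it holds off a hypersurface; by
quantifier elimination over the closed field [K], for an irreducible set and a
first-order property, either the property or its negation is generic. *)

(** The obstacle is that one [L] must serve several purposes: be spanned by points of [X], have a
    basis of points of [Y], and keep the quadrics independent. The last two are definable properties
    of a tuple of [c + 1] vectors that depend only on its span, and such a property is generic for
    tuples from [X] exactly when it is generic for tuples of arbitrary vectors. So each is proved
    where it is easiest and then carried to tuples from [X]. The faces of the simplex are treated
    alike without any monodromy: whether the span of [s] general points of [X] meets [Y] off its
    proper faces is a definable question about [s] points, answered once, and the answer applies to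
    every choice of [s] vertices. Dimension enters through linear projections with dense image.
    Points are vectors of the affine cone, so dimension at least [n] means a projection onto a space
    of dimension [n + 1], and [c + (n + 1)] is the number of homogeneous coordinates. A closed set
    may be given by infinitely many equations; since only general points matter, a definable generic
    part of it replaces a finite system of equations. *)

Section PolynomialFunctions.
Variable K : closedFieldType.

Inductive polyfun (I T : Type) (x : I -> T -> K) : (T -> K) -> Prop :=
| polyfun_coord i : polyfun x (x i)
| polyfun_const a : polyfun x (fun=> a)
| polyfunD f g : polyfun x f -> polyfun x g -> polyfun x (fun t => f t + g t)
| polyfunM f g : polyfun x f -> polyfun x g -> polyfun x (fun t => f t * g t)
| polyfun_ext f g : f =1 g -> polyfun x f -> polyfun x g.

Lemma polyfun_comp (I J T U : Type) (x : I -> T -> K) (y : J -> U -> K)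
    (phi : T -> U) (f : U -> K) :
  (forall j, polyfun x (fun t => y j (phi t))) ->
  polyfun y f -> polyfun x (fun t => f (phi t)).
Proof.
move=> xphi; elim=> [j|a|g h _ xg _ xh|g h _ xg _ xh|g h gh _ xg].
- exact: xphi.
- exact: polyfun_const.
- exact: polyfunD.
- exact: polyfunM.
by apply: polyfun_ext xg => t; rewrite gh.
Qed.

Section Closure.
Variables (I T : Type) (x : I -> T -> K).

Lemma polyfunN f : polyfun x f -> polyfun x (fun t => - f t).
Proof.
move=> xf; apply: polyfun_ext (polyfunM (polyfun_const x (- 1)) xf) => t /=.
by rewrite mulN1r.
Qed.

Lemma polyfunB f g :
  polyfun x f -> polyfun x g -> polyfun x (fun t => f t - g t).
Proof. by move=> xf xg; apply: polyfunD xf (polyfunN xg). Qed.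

Lemma polyfun_sum (J : Type) (r : seq J) (P : pred J) (F : J -> T -> K) :
  (forall j, polyfun x (F j)) -> polyfun x (fun t => \sum_(j <- r | P j) F j t).
Proof.
move=> xF; elim: r => [|j r xr].
  by apply: polyfun_ext (polyfun_const x 0) => t; rewrite big_nil.
case Pj: (P j); last by apply: polyfun_ext xr => t; rewrite big_cons Pj.
by apply: polyfun_ext (polyfunD (xF j) xr) => t; rewrite big_cons Pj.
Qed.

Lemma polyfun_prod (J : Type) (r : seq J) (P : pred J) (F : J -> T -> K) :
  (forall j, polyfun x (F j)) -> polyfun x (fun t => \prod_(j <- r | P j) F j t).
Proof.
move=> xF; elim: r => [|j r xr].
  by apply: polyfun_ext (polyfun_const x 1) => t; rewrite big_nil.
case Pj: (P j); last by apply: polyfun_ext xr => t; rewrite big_cons Pj.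
by apply: polyfun_ext (polyfunM (xF j) xr) => t; rewrite big_cons Pj.
Qed.

Lemma polyfunX f n : polyfun x f -> polyfun x (fun t => f t ^+ n).
Proof.
move=> xf; elim: n => [|n xn].
  by apply: polyfun_ext (polyfun_const x 1) => t; rewrite expr0.
by apply: polyfun_ext (polyfunM xf xn) => t; rewrite exprS.
Qed.

Lemma polyfun_meval n (p : {mpoly K[n]}) (F : 'I_n -> T -> K) :
  (forall j, polyfun x (F j)) -> polyfun x (fun t => p.@[fun j => F j t]).
Proof.
move=> xF; apply: (@polyfun_ext _ _ _ (fun t =>
  \sum_(m <- msupp p) p@_m * \prod_i F i t ^+ m i)).
  by move=> t; rewrite mevalE.
apply: polyfun_sum => m; apply: polyfunM; first exact: polyfun_const.
by apply: polyfun_prod => i; apply: polyfunX.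
Qed.

Definition polymap s m (phi : T -> 'M[K]_(s, m)) :=
  forall i j, polyfun x (fun t => phi t i j).

Lemma polymap_const s m (A : 'M[K]_(s, m)) : polymap (fun=> A).
Proof. by move=> i j; apply: polyfun_const. Qed.

Lemma polymapD s m (f g : T -> 'M[K]_(s, m)) :
  polymap f -> polymap g -> polymap (fun t => f t + g t).
Proof.
by move=> xf xg i j; apply: polyfun_ext (polyfunD (xf i j) (xg i j)) => t; rewrite mxE.
Qed.

Lemma polymapM s m n (f : T -> 'M[K]_(s, m)) (g : T -> 'M[K]_(m, n)) :
  polymap f -> polymap g -> polymap (fun t => f t *m g t).
Proof.
move=> xf xg i j; apply: (@polyfun_ext _ _ _ (fun t => \sum_k f t i k * g t k j)).
  by move=> t; rewrite mxE.
by apply: polyfun_sum => k; apply: polyfunM.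
Qed.

Lemma polymap_mxsub s m s' m' (a : 'I_s' -> 'I_s) (b : 'I_m' -> 'I_m)
    (f : T -> 'M[K]_(s, m)) :
  polymap f -> polymap (fun t => mxsub a b (f t)).
Proof. by move=> xf i j; apply: polyfun_ext (xf (a i) (b j)) => t; rewrite mxE. Qed.

Lemma polymap_row s m i (f : T -> 'M[K]_(s, m)) :
  polymap f -> polymap (fun t => row i (f t)).
Proof. by move=> xf k j; apply: polyfun_ext (xf i j) => t; rewrite mxE. Qed.

Lemma polyfun_det s (f : T -> 'M[K]_s) : polymap f -> polyfun x (fun t => \det (f t)).
Proof.
move=> xf; apply: polyfun_sum => u; apply: polyfunM; first exact: polyfun_const.
by apply: polyfun_prod => i.
Qed.

End Closure.

Definition mxcoord s m (ij : 'I_s * 'I_m) (A : 'M[K]_(s, m)) := A ij.1 ij.2.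

Lemma polymap_id s m : polymap (@mxcoord s m) id.
Proof. by move=> i j; apply: (polyfun_coord (@mxcoord s m) (i, j)). Qed.

Lemma polyfun_mxcomp I T (x : I -> T -> K) s m (phi : T -> 'M[K]_(s, m)) f :
  polymap x phi -> polyfun (@mxcoord s m) f -> polyfun x (fun t => f (phi t)).
Proof. by move=> xphi; apply: polyfun_comp => -[i j]; apply: xphi. Qed.

Lemma polyfun_line I T (x : I -> T -> K) (f : T -> K) (phi : K -> T) :
  (forall i, exists p : {poly K}, forall s, x i (phi s) = p.[s]) ->
  polyfun x f -> exists p : {poly K}, forall s, f (phi s) = p.[s].
Proof.
move=> xphi; elim=> [j|a|g h _ [p Ep] _ [q Eq]|g h _ [p Ep] _ [q Eq]|g h gh _ [p Ep]].
- exact: xphi.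
- by exists a%:P => s; rewrite hornerC.
- by exists (p + q) => s; rewrite hornerD Ep Eq.
- by exists (p * q) => s; rewrite hornerM Ep Eq.
by exists p => s; rewrite -gh.
Qed.

Lemma polyfun_mxline s m (f : 'M[K]_(s, m) -> K) A B :
  polyfun (@mxcoord s m) f ->
  exists p : {poly K}, forall a, f (A + a *: B) = p.[a].
Proof.
apply: polyfun_line => -[i j]; exists ((A i j)%:P + (B i j)%:P * 'X) => a.
by rewrite /mxcoord !mxE !hornerE mulrC.
Qed.

Lemma poly_nonroot (p : {poly K}) : p != 0 -> exists a, p.[a] != 0.
Proof. by move/closed_nonrootP => [a]; exists a. Qed.

Lemma poly_eq0_horner (p : {poly K}) : (forall a, p.[a] = 0) -> p = 0.
Proof.
by move=> p0; apply/eqP/negP => /negP/poly_nonroot[a]; rewrite p0 eqxx.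
Qed.

(** * Definable sets and generic points *)

Definition meets T (Z : T -> Prop) (f : T -> K) := exists2 z, Z z & f z != 0.

(** Equivalently, the polynomial functions restricted to [Z] form a domain. This makes sense for
    sets that are not closed and for sets of matrices with rows in given sets. *)
Definition irreducible_set I T (x : I -> T -> K) (Z : T -> Prop) :=
  (exists z, Z z) /\
  forall f g, polyfun x f -> polyfun x g -> meets Z f -> meets Z g ->
    meets Z (fun z => f z * g z).

Definition generically I T (x : I -> T -> K) (Z P : T -> Prop) :=
  exists g, [/\ polyfun x g, meets Z g & forall z, Z z -> g z != 0 -> P z].

(* Definability is phrased by substitution of arbitrary terms for the
   coordinates, which makes it stable under polynomial maps for free. *)
Definition definable I T (x : I -> T -> K) (P : T -> Prop) :=
  exists F : (I -> GRing.term K) -> GRing.formula K, forall t e z,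
    (forall i, GRing.eval e (t i) = x i z) -> (GRing.holds e (F t) <-> P z).

Section Definable.
Variables (I T : Type) (x : I -> T -> K).

Lemma polyfun_term f : polyfun x f ->
  exists F : (I -> GRing.term K) -> GRing.term K, forall t e z,
    (forall i, GRing.eval e (t i) = x i z) -> GRing.eval e (F t) = f z.
Proof.
elim=> [j|a|g h _ [p Ep] _ [q Eq]|g h _ [p Ep] _ [q Eq]|g h gh _ [p Ep]].
- by exists (fun t => t j) => t e z; apply.
- by exists (fun t => GRing.Const a).
- by exists (fun t => GRing.Add (p t) (q t)) => t e z tz /=; rewrite (Ep _ _ _ tz) (Eq _ _ _ tz).
- by exists (fun t => GRing.Mul (p t) (q t)) => t e z tz /=; rewrite (Ep _ _ _ tz) (Eq _ _ _ tz).
by exists p => t e z tz; rewrite (Ep _ _ _ tz) gh.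
Qed.

Lemma definable_true : definable x (fun=> True).
Proof. by exists (fun=> GRing.Bool true). Qed.

Lemma definable_eq0 f : polyfun x f -> definable x (fun z => f z = 0).
Proof.
case/polyfun_term=> F EF; exists (fun t => GRing.Equal (F t) (GRing.Const 0)).
by move=> t e z tz /=; rewrite (EF _ _ _ tz).
Qed.

Lemma definable_not P : definable x P -> definable x (fun z => ~ P z).
Proof.
by case=> F EF; exists (fun t => GRing.Not (F t)) => t e z /(EF t e z) /=; tauto.
Qed.

Lemma definable_and P Q :
  definable x P -> definable x Q -> definable x (fun z => P z /\ Q z).
Proof.
case=> F EF [G EG]; exists (fun t => GRing.And (F t) (G t)) => t e z tz /=.
by have := EF t e z tz; have := EG t e z tz; tauto.
Qed.

Lemma definable_imp P Q :
  definable x P -> definable x Q -> definable x (fun z => P z -> Q z).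
Proof.
case=> F EF [G EG]; exists (fun t => GRing.Implies (F t) (G t)) => t e z tz /=.
by have := EF t e z tz; have := EG t e z tz; tauto.
Qed.

Lemma definable_ext P Q : (forall z, P z <-> Q z) -> definable x P -> definable x Q.
Proof. by move=> PQ [F EF]; exists F => t e z /(EF t e z); rewrite PQ. Qed.

Lemma definable_neq0 f : polyfun x f -> definable x (fun z => f z != 0).
Proof.
move=> xf; apply: definable_ext (definable_not (definable_eq0 xf)) => z.
by split=> [/eqP|/eqP].
Qed.

Lemma definable_all (J : Type) (r : seq J) (P : J -> T -> Prop) :
  (forall j, definable x (P j)) ->
  definable x (fun z => foldr (fun j Q => P j z /\ Q) True r).
Proof.
move=> xP; elim: r => [|j r IH] /=; last exact: definable_and.
apply: (definable_ext _ (definable_eq0 (polyfun_const x 0))) => z.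
by [].
Qed.

Lemma definable_forall (J : finType) (P : J -> T -> Prop) :
  (forall j, definable x (P j)) -> definable x (fun z => forall j, P j z).
Proof.
move=> xP; apply: definable_ext (definable_all (enum J) xP) => z.
have E (r : seq J) : foldr (fun j Q => P j z /\ Q) True r <-> forall j, j \in r -> P j z.
  elim: r => //= j r ->; split=> [[Pj Pr] i|Pr].
    by rewrite inE => /predU1P[->|/Pr].
  by split=> [|i ir]; apply: Pr; rewrite inE ?eqxx ?ir ?orbT.
by rewrite E; split=> Pz j; [apply: Pz; rewrite mem_enum | move=> _; apply: Pz].
Qed.

Lemma definable_sub (J : finType) U (y : J -> U -> K) (phi : T -> U) P :
  (forall j, polyfun x (fun t => y j (phi t))) -> definable y P ->
  definable x (fun z => P (phi z)).
Proof.
move=> yphi [F EF].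
have [G EG] : exists G : J -> (I -> GRing.term K) -> GRing.term K, forall j t e z,
    (forall i, GRing.eval e (t i) = x i z) -> GRing.eval e (G j t) = y j (phi z).
  suff: forall j, exists Gj : (I -> GRing.term K) -> GRing.term K, forall t e z,
    (forall i, GRing.eval e (t i) = x i z) -> GRing.eval e (Gj t) = y j (phi z).
    by move/fin_all_exists.
  by move=> j; have [Gj] := polyfun_term (yphi j); exists Gj.
exists (fun t => F (fun j => G j t)) => t e z tz; apply: EF => j.
exact: EG.
Qed.

Definition extcoord s m (k : I + 'I_s * 'I_m) (zB : T * 'M[K]_(s, m)) :=
  match k with inl i => x i zB.1 | inr ij => zB.2 ij.1 ij.2 end.

End Definable.

Lemma eval_ub_var (t : GRing.term K) n (e e' : seq K) :
  (GRing.ub_var t <= n)%N -> (forall k, (k < n)%N -> e`_k = e'`_k) ->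
  GRing.eval e t = GRing.eval e' t.
Proof.
move=> + ee'; elim: t => //= [t1 IH1 t2 IH2|t IH|t IH k|t1 IH1 t2 IH2|t IH|t IH k];
  rewrite ?geq_max.
- by case/andP=> /IH1-> /IH2->.
- by move/IH->.
- by move/IH->.
- by case/andP=> /IH1-> /IH2->.
- by move/IH->.
- by move/IH->.
Qed.

(** The entries of the bound matrix are assigned to variables numbered from [nv t] on, beyond all
    variables of the substituted terms, so that quantifying over them captures nothing. *)
Lemma definable_ex (I : finType) T (x : I -> T -> K) s m
    (P : T -> 'M[K]_(s, m) -> Prop) :
  definable (@extcoord I T x s m) (fun zB => P zB.1 zB.2) ->
  definable x (fun z => exists B, P z B).
Proof.
case=> F EF; pose J := ('I_s * 'I_m)%type.
pose nv (t : I -> GRing.term K) := \max_i GRing.ub_var (t i).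
pose tt t (k : I + J) := match k with inl i => t i
  | inr p => GRing.Var K (nv t + enum_rank p) end.
exists (fun t => foldr (@GRing.Exists K) (F (tt t)) (iota (nv t) #|{: J}|)).
move=> t e z tz; split=> [/GRing.foldExistsP[e' ee' Fe']|[B PB]].
  pose B : 'M[K]_(s, m) := \matrix_(i, j) e'`_(nv t + enum_rank (i, j)).
  exists B; apply: (proj1 (EF (tt t) e' (z, B) _)) Fe' => -[i|[i j]] /=; last by rewrite mxE.
  rewrite -tz; symmetry; apply: (@eval_ub_var _ (nv t)).
    exact: (leq_bigmax i).
  by move=> k kt; apply: ee'; rewrite !inE mem_iota leqNgt kt.
apply/GRing.foldExistsP.
pose e0 k := if (k < nv t)%N then e`_k else
  nth e`_k [seq B p.1 p.2 | p <- enum {: J}] (k - nv t).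
(* The new environment must agree with [e] outside the bound block, also after it; hence the extra
   length [size e] and the default value in [e0]. *)
pose e' := mkseq e0 (nv t + #|{: J}| + size e).
have e'E k : e'`_k = e0 k.
  case: (ltnP k (nv t + #|{: J}| + size e)) => kn; first by rewrite nth_mkseq.
  rewrite nth_default ?size_mkseq // /e0.
  have k1 : (nv t + #|{: J}| <= k)%N by apply: leq_trans kn; rewrite leq_addr.
  have k2 : (size e <= k)%N by apply: leq_trans kn; rewrite leq_addl.
  rewrite ltnNge (leq_trans _ k1) ?leq_addr //=.
  rewrite nth_default; first by rewrite nth_default.
  by rewrite size_map -cardE leq_subRL // (leq_trans _ k1) // leq_addr.
exists e'.
  move=> k; rewrite !inE mem_iota negb_and -ltnNge -leqNgt e'E /e0.
  case: ltnP => //= kt kn.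
  by rewrite [RHS]nth_default // size_map -cardE leq_subRL.
apply: (proj2 (EF (tt t) e' (z, B) _)) PB => -[i|[i j]] /=.
  rewrite -tz; symmetry; apply: (@eval_ub_var _ (nv t)); first exact: (leq_bigmax i).
  by move=> k kt; rewrite e'E /e0 kt.
rewrite e'E /e0 ltnNge leq_addr /= addKn (nth_map (i, j)) -?cardE ?ltn_ord //.
by rewrite nth_enum_rank.
Qed.

Section Dichotomy.
Variables (I : finType) (T : Type) (x : I -> T -> K) (Z : T -> Prop).
Hypothesis irrZ : irreducible_set x Z.

Lemma generically_and P Q :
  generically x Z P -> generically x Z Q -> generically x Z (fun z => P z /\ Q z).
Proof.
case=> f [xf Zf fP] [g [xg Zg gQ]]; exists (fun z => f z * g z).
split; [exact: polyfunM | exact: (irrZ.2) |].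
by move=> z Zz; rewrite mulf_eq0 => /norP[fz gz]; split; [apply: fP | apply: gQ].
Qed.

Lemma generically_true (P : T -> Prop) : (forall z, Z z -> P z) -> generically x Z P.
Proof.
move=> ZP; exists (fun=> 1); split; [exact: polyfun_const | | by move=> z /ZP].
by case: irrZ.1 => z; exists z; rewrite ?oner_eq0.
Qed.

Lemma generically_imp (P Q : T -> Prop) : generically x Z P ->
  (forall z, Z z -> P z -> Q z) -> generically x Z Q.
Proof. by move=> [f [xf Zf fP]] PQ; exists f; split=> // z Zz fz; apply: PQ => //; apply: fP. Qed.

Lemma generically_ex P : generically x Z P -> exists2 z, Z z & P z.
Proof. by case=> f [xf [z Zz fz] fP]; exists z => //; apply: fP. Qed.

Lemma generically_neq0 f : polyfun x f -> meets Z f -> generically x Z (fun z => f z != 0).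
Proof. by move=> xf Zf; exists f. Qed.

Lemma generically_forall (J : finType) (P : J -> T -> Prop) :
  (forall j, generically x Z (P j)) -> generically x Z (fun z => forall j, P j z).
Proof.
move=> ZP.
have E (r : seq J) : generically x Z (fun z => forall j, j \in r -> P j z).
  elim: r => [|j r IH]; first exact: generically_true.
  apply: (generically_imp (generically_and (ZP j) IH)) => z _ [Pj Pr] i.
  by rewrite inE => /predU1P[->|/Pr].
by apply: (generically_imp (E (enum J))) => z _ Pz j; apply: Pz; rewrite mem_enum.
Qed.

Lemma rterm_polyfun (t : GRing.term K) : GRing.rterm t ->
  polyfun x (fun z => GRing.eval [seq x i z | i <- enum I] t).
Proof.
elim: t => //= [k|a|n|t1 IH1 t2 IH2|t IH|t IH n|t1 IH1 t2 IH2|t IH n].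
- move=> _; case: (ltnP k (size (enum I))) => kn.
    have [i0 _] : exists i, i \in enum I.
      by case: (enum I) kn => // i r _; exists i; rewrite mem_head.
    apply: (@polyfun_ext _ _ _ (x (nth i0 (enum I) k))); last exact: polyfun_coord.
    by move=> z /=; rewrite [RHS](nth_map i0).
  apply: polyfun_ext (polyfun_const x 0) => z.
  by rewrite nth_default // size_map.
- by move=> _; apply: polyfun_const.
- by move=> _; apply: polyfun_const.
- by case/andP=> /IH1 ? /IH2 ?; apply: polyfunD.
- by move/IH; apply: polyfunN.
- move/IH=> xt; apply: polyfun_ext (polyfunM xt (polyfun_const x n%:R)) => z.
  by rewrite mulr_natr.
- by case/andP=> /IH1 ? /IH2 ?; apply: polyfunM.
- by move/IH; apply: polyfunX.
Qed.

(** An equation compares two polynomial functions: their difference vanishes on all of [Z] or is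
    generically nonzero. Irreducibility lets finitely many such alternatives be intersected. *)
Lemma qf_dichotomy (q : GRing.formula K) : GRing.qf_form q -> GRing.rformula q ->
  let P z := GRing.qf_eval [seq x i z | i <- enum I] q in
  generically x Z P \/ generically x Z (fun z => ~ P z).
Proof.
elim: q => //=.
- by case=> _ _; [left|right]; apply: generically_true.
- move=> t1 t2 _ /andP[r1 r2].
  have xf := polyfunB (rterm_polyfun r1) (rterm_polyfun r2).
  case: (classic (meets Z (fun z => GRing.eval [seq x i z | i <- enum I] t1 -
    GRing.eval [seq x i z | i <- enum I] t2))) => [Zf|Zf].
    right; apply: (generically_imp (generically_neq0 xf Zf)) => z _.
    by rewrite subr_eq0 => /negP.
  left; apply: generically_true => z Zz; apply/negP => /negP ne; apply: Zf.
  by exists z => //; rewrite subr_eq0.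
- move=> f IHf g IHg /andP[qf qg] /andP[rf rg].
  case: (IHf qf rf) => Pf; last first.
    by right; apply: (generically_imp Pf) => z _ nf /andP[].
  case: (IHg qg rg) => Pg; last first.
    by right; apply: (generically_imp Pg) => z _ ng /andP[].
  by left; apply: (generically_imp (generically_and Pf Pg)) => z _ [-> ->].
- move=> f IHf g IHg /andP[qf qg] /andP[rf rg].
  case: (IHf qf rf) => Pf; first by left; apply: (generically_imp Pf) => z _ ->.
  case: (IHg qg rg) => Pg; first by left; apply: (generically_imp Pg) => z _ ->; rewrite orbT.
  by right; apply: (generically_imp (generically_and Pf Pg)) => z _ [nf ng] /orP[].
- move=> f IHf g IHg /andP[qf qg] /andP[rf rg].
  case: (IHf qf rf) => Pf; last first.
    by left; apply: (generically_imp Pf) => z _ nf; apply/implyP => /nf.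
  case: (IHg qg rg) => Pg; first by left; apply: (generically_imp Pg) => z _ ->; rewrite implybT.
  by right; apply: (generically_imp (generically_and Pf Pg)) => z _ [nf ng] /implyP /(_ nf).
- move=> f IHf qf rf; case: (IHf qf rf) => Pf.
    by right; apply: (generically_imp Pf) => z _ -> .
  by left; apply: (generically_imp Pf) => z _ /negP.
Qed.

(** Quantifier elimination, after inverses are removed from the terms, reduces this to the
    quantifier-free case. *)
Lemma definable_dichotomy P : definable x P ->
  generically x Z P \/ generically x Z (fun z => ~ P z).
Proof.
case=> F EF.
pose f := F (fun i => GRing.Var K (enum_rank i)).
pose q := GRing.quantifier_elim (@ClosedFieldQE.ex_elim K) (GRing.to_rform f).
have rf := GRing.to_rform_rformula f.
have /andP[qq rq] := GRing.quantifier_elim_wf (@ClosedFieldQE.wf_ex_elim K) rf.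
have PE z : GRing.qf_eval [seq x i z | i <- enum I] q <-> P z.
  have ok := @ClosedFieldQE.holds_ex_elim K (@solve_monicpoly K).
  have := GRing.quantifier_elim_rformP (@ClosedFieldQE.wf_ex_elim K) ok
    [seq x i z | i <- enum I] rf.
  rewrite -/q => /rwP <-; rewrite GRing.to_rformP; apply: EF => i /=.
  by rewrite (nth_map i) ?nth_enum_rank // -cardE.
case: (qf_dichotomy qq rq) => H; [left|right];
  by apply: (generically_imp H) => z _; rewrite PE.
Qed.

End Dichotomy.
End PolynomialFunctions.

Lemma classical_least (P : nat -> Prop) :
  (exists n, P n) -> exists2 n, P n & forall k, (k < n)%N -> ~ P k.
Proof.
case=> n; elim/ltn_ind: n => n IH Pn.
case: (classic (exists2 k, (k < n)%N & P k)) => [[k kn Pk]|nP]; first exact: IH Pk.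
by exists n => // k kn Pk; apply: nP; exists k.
Qed.

(** * Irreducibility of affine space and of products *)

Section Irreducible.
Variable K : closedFieldType.

Notation mxpoly s m := (polyfun (@mxcoord K s m)).
Notation rows S := (fun A => forall i, S i (row i A)).

(** On the line joining a nonzero of [f] to a nonzero of [g], both become nonzero polynomials in one
    variable. *)
Lemma irreducible_setT s m : irreducible_set (@mxcoord K s m) (fun=> True).
Proof.
split; first by exists 0.
move=> f g xf xg [A _ fA] [B _ gB].
have [p Ep] := polyfun_mxline A (B - A) xf.
have [q Eq] := polyfun_mxline A (B - A) xg.
have p0 : p != 0.
  by apply: contraNneq fA => p0; rewrite -[A]addr0 -(scale0r (B - A)) Ep p0 horner0.
have q0 : q != 0.
  apply: contraNneq gB => q0.
  by have := Eq 1; rewrite q0 horner0 scale1r addrC subrK => ->.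
have [a pqa] : exists a, (p * q).[a] != 0 by apply: poly_nonroot; rewrite mulf_neq0.
by exists (A + a *: (B - A)) => //; rewrite Ep Eq -hornerM.
Qed.

Definition setrow s m (A : 'M[K]_(s, m)) (j : 'I_s) (u : 'rV_m) : 'M[K]_(s, m) :=
  \matrix_(i, k) if i == j then u 0 k else A i k.

Lemma row_setrow s m (A : 'M[K]_(s, m)) j u i :
  row i (setrow A j u) = if i == j then u else row i A.
Proof. by apply/rowP=> k; rewrite !mxE; case: eqP => // _; rewrite mxE. Qed.

Lemma setrow_row s m (A : 'M[K]_(s, m)) j : setrow A j (row j A) = A.
Proof. by apply/row_matrixP=> i; rewrite row_setrow; case: eqP => // ->. Qed.

Lemma setrowK s m (A : 'M[K]_(s, m)) j u v : setrow (setrow A j u) j v = setrow A j v.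
Proof. by apply/row_matrixP=> i; rewrite !row_setrow; case: eqP. Qed.

Lemma polymap_setrow I T (x : I -> T -> K) s m j (f : T -> 'M[K]_(s, m)) (g : T -> 'rV_m) :
  polymap x f -> polymap x g -> polymap x (fun t => setrow (f t) j (g t)).
Proof.
move=> xf xg i k; case Eij: (i == j).
  by apply: polyfun_ext (xg 0 k) => t; rewrite mxE Eij.
by apply: polyfun_ext (xf i k) => t; rewrite mxE Eij.
Qed.

Lemma polyfun_setrow s m (A : 'M[K]_(s, m)) j f :
  mxpoly s m f -> mxpoly 1 m (fun u => f (setrow A j u)).
Proof.
apply: polyfun_mxcomp; apply: polymap_setrow; first exact: polymap_const.
exact: polymap_id.
Qed.

Lemma meets_setrow s m (S : 'I_s -> 'rV[K]_m -> Prop) (f : 'M[K]_(s, m) -> K) A j :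
  rows S A -> f A != 0 -> meets (S j) (fun u => f (setrow A j u)).
Proof. by move=> SA fA; exists (row j A); rewrite ?setrow_row. Qed.

(** The two witnesses are made equal one row at a time: irreducibility of [S j] supplies a common
    row [u] that can replace row [j] in both without killing [f] or [g]. *)
Lemma irreducible_rows s m (S : 'I_s -> 'rV[K]_m -> Prop) :
  (forall i, irreducible_set (@mxcoord K 1 m) (S i)) ->
  irreducible_set (@mxcoord K s m) (rows S).
Proof.
move=> irrS; split.
  have [f Sf] := fin_all_exists (fun i => (irrS i).1).
  by exists (\matrix_i f i) => i; rewrite rowK.
move=> f g xf xg [A SA fA] [B SB gB].
suff [A' [B' [SA' SB' fA' gB' EAB]]] : exists A' B', [/\ rows S A', rows S B',
    f A' != 0, g B' != 0 & forall i, i \in enum 'I_s -> row i A' = row i B'].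
  have EA : A' = B' by apply/row_matrixP => i; apply: EAB; rewrite mem_enum.
  by exists A' => //; rewrite mulf_neq0 // EA.
elim: (enum 'I_s) => [|j r [A' [B' [SA' SB' fA' gB' EAB]]]]; first by exists A, B.
have [u Su /=] := (irrS j).2 _ _ (polyfun_setrow A' j xf) (polyfun_setrow B' j xg)
  (meets_setrow j SA' fA') (meets_setrow j SB' gB').
rewrite mulf_eq0 => /norP[fu gu].
exists (setrow A' j u), (setrow B' j u); split=> // i; rewrite !row_setrow.
- by case: eqP => [->|] //.
- by case: eqP => [->|] //.
by case: eqP => // ij; rewrite inE => /predU1P[|] //; apply: EAB.
Qed.

(** * Generic finite description of an irreducible closed set *)

(** The polynomial variable stands for variable number [r], and the coefficients involve only the
    variables before it. *)
Definition eval2 r (v : nat -> K) (P : {poly {mpoly K[r]}}) : K :=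
  (map_poly (meval (fun i : 'I_r => v i)) P).[v r].

Lemma eval2D r v (P Q : {poly {mpoly K[r]}}) : eval2 v (P + Q) = eval2 v P + eval2 v Q.
Proof. by rewrite /eval2 rmorphD hornerD. Qed.

Lemma eval2M r v (P Q : {poly {mpoly K[r]}}) : eval2 v (P * Q) = eval2 v P * eval2 v Q.
Proof. by rewrite /eval2 rmorphM hornerM. Qed.

Lemma eval2C r v (c : {mpoly K[r]}) : eval2 v c%:P = c.@[fun i => v i].
Proof. by rewrite /eval2 map_polyC hornerC. Qed.

Lemma eval2X r v : eval2 v ('X : {poly {mpoly K[r]}}) = v r.
Proof. by rewrite /eval2 map_polyX hornerX. Qed.

Lemma eval2Z r v (c : {mpoly K[r]}) P : eval2 v (c *: P) = c.@[fun i => v i] * eval2 v P.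
Proof. by rewrite -mul_polyC eval2M eval2C. Qed.

Lemma mpoly_eval2 r (p : {mpoly K[r.+1]}) :
  exists P : {poly {mpoly K[r]}}, forall v : nat -> K,
    p.@[fun i => v i] = eval2 v P.
Proof.
have evM v := @eval2M r v; have ev1 v : eval2 v (1 : {poly {mpoly K[r]}}) = 1.
  by rewrite -[1]/(1%:P) eval2C meval1.
elim/mpolyind: p => [|c m p _ _ [P EP]].
  by exists 0 => v; rewrite meval0 /eval2 map_poly0 horner0.
pose M i : {poly {mpoly K[r]}} := if insub i is Some j then ('X_j)%:P else 'X.
have EM v (i : 'I_r.+1) : eval2 v (M i) = v i.
  rewrite /M; case: insubP => [j _ ji|]; first by rewrite eval2C mevalXU ji.
  rewrite -leqNgt => ri; rewrite eval2X; congr v; apply/eqP.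
  by rewrite eqn_leq ri -ltnS ltn_ord.
exists ((c%:MP)%:P * \prod_(i < r.+1) M i ^+ m i + P) => v.
rewrite mevalD mevalZ mevalX EP eval2D eval2M eval2C mevalC; congr (_ * _ + _).
rewrite (big_morph (eval2 v) (evM v) (ev1 v)); apply: eq_bigr => i _.
elim: (m i) => [|k IH]; first by rewrite !expr0 ev1.
by rewrite !exprS eval2M EM IH.
Qed.

Section Triangular.
Variables (I : finType) (T : Type) (x : I -> T -> K) (X : T -> Prop).
Hypothesis irrX : irreducible_set x X.
Variables (y : nat -> T -> K).
Hypothesis xy : forall k, polyfun x (y k).

Let at_ t : nat -> K := fun k => y k t.

Lemma polyfun_eval2 r (P : {poly {mpoly K[r]}}) : polyfun x (fun t => eval2 (at_ t) P).
Proof.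
elim/poly_ind: P => [|P c IH].
  by apply: polyfun_ext (polyfun_const x 0) => t; rewrite /eval2 map_poly0 horner0.
apply: (@polyfun_ext _ _ _ _ (fun t => eval2 (at_ t) P * y r t + c.@[fun i => at_ t i])).
  by move=> t; rewrite eval2D eval2M eval2X eval2C.
apply: (polyfunD (polyfunM IH (xy r))); apply: polyfun_meval => i; exact: xy.
Qed.

Let vanishes (P : T -> K) := forall z, X z -> P z = 0.

Lemma vanishes_or_meets f : vanishes f \/ meets X f.
Proof.
case: (classic (meets X f)) => Xf; [by right | left => z Xz].
by apply/eqP/negP => /negP fz; apply: Xf; exists z.
Qed.

Lemma vanishesM f g : polyfun x f -> polyfun x g -> meets X f ->
  vanishes (fun z => f z * g z) -> vanishes g.
Proof.
move=> xf xg Xf fg; case: (vanishes_or_meets g) => // Xg.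
by have [z /fg->] := irrX.2 _ _ xf xg Xf Xg; rewrite eqxx.
Qed.

(* A polynomial relation whose leading coefficient vanishes on [X] can be
   shortened; when no shorter relation has a nonzero leading coefficient, all
   the coefficients vanish. *)
Lemma vanishing_coefs r n :
  (forall P : {poly {mpoly K[r]}}, (size P < n)%N -> vanishes (fun z => eval2 (at_ z) P) ->
     vanishes (fun z => (lead_coef P).@[fun i => at_ z i])) ->
  forall P : {poly {mpoly K[r]}}, (size P < n)%N -> vanishes (fun z => eval2 (at_ z) P) ->
    forall k, vanishes (fun z => (P`_k).@[fun i => at_ z i]).
Proof.
move=> lcn P; have [s] := ubnP (size P); elim: s P => // s IH P Ps Pn XP k.
have [->|P0] := eqVneq P 0; first by move=> z _; rewrite coef0 meval0.
have lc0 := lcn P Pn XP.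
pose Q := P - lead_coef P *: 'X^((size P).-1).
have sP : (0 < size P)%N by rewrite size_poly_gt0.
have sQ : (size Q < size P)%N.
  rewrite -[X in (_ < X)%N]prednK // ltnS; apply/leq_sizeP => j.
  rewrite leq_eqVlt => /predU1P[<-|ltj].
    by rewrite coefB coefZ coefXn eqxx mulr1 lead_coefE subrr.
  rewrite coefB coefZ coefXn gtn_eqF // mulr0 subr0.
  by rewrite nth_default // -[size P]prednK.
have XQ : vanishes (fun z => eval2 (at_ z) Q).
  move=> z Xz; rewrite /Q -scaleNr eval2D eval2Z XP // mevalN lc0 //.
  by rewrite oppr0 mul0r addr0.
have Qk := IH Q (leq_trans sQ Ps) (ltn_trans sQ Pn) XQ.
move=> z Xz; have := Qk k z Xz; rewrite coefB coefZ coefXn.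
case: eqP => [->|_]; last by rewrite mulr0 subr0.
by move=> _; rewrite -lead_coefE lc0.
Qed.

Lemma pseudo_division r (P Q : {poly {mpoly K[r]}}) :
  vanishes (fun z => eval2 (at_ z) Q) -> vanishes (fun z => eval2 (at_ z) P) ->
  exists e S R, [/\ lead_coef Q ^+ e *: P = S * Q + R, Q != 0 -> (size R < size Q)%N
    & vanishes (fun z => eval2 (at_ z) R)].
Proof.
move=> XQ XP; exists (scalp P Q), (P %/ Q), (P %% Q); split.
- exact: Pdiv.Idomain.divp_eq.
- by move=> Q0; rewrite ltn_modp.
move=> z Xz; have := congr1 (eval2 (at_ z)) (Pdiv.Idomain.divp_eq P Q).
by rewrite eval2Z eval2D eval2M XP // XQ // !mulr0 add0r.
Qed.

(** A triangular system takes the place of a finite basis of the ideal: for each new variable, keep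
    a shortest relation [P] whose leading coefficient is not identically zero on [X], if there is
    one. Pseudo-division by [P] turns any other relation into a shorter one, whose coefficients
    vanish on [X] by minimality and are handled by induction; the leading coefficient of [P] is
    invertible at the points of [Q]. *)
Lemma generic_equations r : exists Q : T -> Prop,
  [/\ definable x Q, generically x X Q & forall t, Q t -> forall p : {mpoly K[r]},
     vanishes (fun z => p.@[fun i => at_ z i]) -> p.@[fun i => at_ t i] = 0].
Proof.
elim: r => [|r [Q [dQ gQ Qp]]].
  exists (fun=> True); split.
  - by apply: definable_ext (definable_eq0 (polyfun_const x 0)).
  - exact: generically_true.
  move=> t _ p Xp; have [z Xz] := irrX.1.
  by rewrite -(Xp z Xz); apply: meval_eq => -[].
pose good n := exists P : {poly {mpoly K[r]}}, [/\ size P = n,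
  vanishes (fun z => eval2 (at_ z) P) & meets X (fun z => (lead_coef P).@[fun i => at_ z i])].
have bad n : (forall k, (k < n)%N -> ~ good k) -> forall P : {poly {mpoly K[r]}},
    (size P < n)%N -> vanishes (fun z => eval2 (at_ z) P) ->
    forall t, Q t -> eval2 (at_ t) P = 0.
  move=> ngood P Pn XP t Qt; rewrite /eval2 horner_coef big1 // => k _.
  rewrite coef_map /= Qp ?mul0r //; apply: (vanishing_coefs _ Pn XP) => P' P'n XP'.
  case: (vanishes_or_meets (fun z => (lead_coef P').@[fun i => at_ z i])) => // lc.
  by case: (ngood (size P') P'n); exists P'.
case: (classic (exists n, good n)) => [/classical_least[n [P [Pn XP lcP]] minn]|ngood].
  exists (fun t => [/\ Q t, eval2 (at_ t) P = 0 & (lead_coef P).@[fun i => at_ t i] != 0]).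
  have xlc : polyfun x (fun t => (lead_coef P).@[fun i => at_ t i]).
    apply: polyfun_meval => i; exact: xy.
  split.
  - apply: definable_ext (definable_and dQ (definable_and
      (definable_eq0 (polyfun_eval2 P)) (definable_neq0 xlc))) => t.
    by split=> [[? [? ?]]|[? ? ?]].
  - apply: (generically_imp (generically_and irrX gQ (generically_neq0 xlc lcP))).
    by move=> z Xz [Qz lcz]; split=> //; apply: XP.
  move=> t [Qt Pt lct] p; have [R ER] := mpoly_eval2 p.
  rewrite ER => Xp.
  have XR : vanishes (fun z => eval2 (at_ z) R) by move=> z Xz; rewrite -ER Xp.
  have [e [S [U [EU sU XU]]]] := pseudo_division XP XR.
  have P0 : P != 0 by apply: contraNneq lct => ->; rewrite lead_coef0 meval0.
  have := congr1 (eval2 (at_ t)) EU; rewrite eval2Z eval2D eval2M Pt mulr0 add0r.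
  rewrite (bad n minn U) // -?Pn ?sU // rmorphXn /= => /eqP.
  by rewrite mulf_eq0 expf_eq0 (negPf lct) andbF => /eqP.
exists Q; split=> // t Qt p; have [R ER] := mpoly_eval2 p.
rewrite ER => Xp; apply: (bad (size R).+1) => //; first by move=> k _ gk; apply: ngood; exists k.
by move=> z Xz; rewrite -ER Xp.
Qed.
End Triangular.
End Irreducible.

(** * From projective sets to affine cones *)

Section Varieties.
Variable K : closedFieldType.
Notation mxpoly s m := (polyfun (@mxcoord K s m)).
Notation irreducible m := (irreducible_set (@mxcoord K 1 m)).

(** These are the properties shared by the cone over a projective variety and the whole space. The
    model provides the definable generic part needed for quantifier elimination. *)
Record variety m (X : 'rV[K]_m -> Prop) : Prop := Variety {
  variety_irreducible : irreducible m X;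
  variety_cone : forall a x, a != 0 -> X x -> X (a *: x);
  variety_model : exists Xo, [/\ definable (@mxcoord K 1 m) Xo,
    forall x, Xo x -> X x & generically (@mxcoord K 1 m) X Xo] }.

Definition spanning m (X : 'rV[K]_m -> Prop) :=
  forall v : 'cV_m, v != 0 -> meets X (fun x => (x *m v) 0 0).

Definition rvset m (Z : pset K m) (x : 'rV[K]_m) := Z (fun i => x 0 i).

Lemma zclosed_ext m (Z : pset K m) v w : zclosed Z -> v =1 w -> Z v -> Z w.
Proof.
case=> S [_ ZS] vw /ZS[[i vi] Sv]; apply/ZS; split; first by exists i; rewrite -vw.
by move=> p Sp; rewrite -(Sv p Sp); apply: meval_eq => j; rewrite vw.
Qed.

Lemma rvset_row m (Z : pset K m) v : zclosed Z -> rvset Z (\row_i v i) <-> Z v.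
Proof.
by move=> cZ; split; apply: zclosed_ext => // i; rewrite mxE.
Qed.

Lemma dhomog_meval m d (p : {mpoly K[m]}) a (v : 'I_m -> K) :
  p \is d.-homog -> p.@[fun i => a * v i] = a ^+ d * p.@[v].
Proof.
move/dhomogP => pd; rewrite !mevalE big_seq [in RHS]big_seq mulr_sumr.
apply: eq_bigr => k kp; under eq_bigr do rewrite exprMn.
by rewrite big_split /= prodrXr -mdegE pd //; ring.
Qed.

Lemma polyfun_mpoly m f : mxpoly 1 m f ->
  exists p : {mpoly K[m]}, forall x : 'rV_m, f x = p.@[fun i => x 0 i].
Proof.
elim=> [[i j]|a|g h _ [p Ep] _ [q Eq]|g h _ [p Ep] _ [q Eq]|g h gh _ [p Ep]].
- by exists 'X_j => x; rewrite mevalXU /mxcoord ord1.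
- by exists a%:MP => x; rewrite mevalC.
- by exists (p + q) => x; rewrite mevalD Ep Eq.
- by exists (p * q) => x; rewrite mevalM Ep Eq.
by exists p => x; rewrite -gh.
Qed.

Lemma zclosed_cone m (Z : pset K m) a x : zclosed Z -> a != 0 -> rvset Z x -> rvset Z (a *: x).
Proof.
case=> S [Shom ZS] a0 /ZS[[i xi] Sx]; apply/ZS; split.
  by exists i; rewrite mxE mulf_neq0.
move=> p Sp; have [d pd] := Shom p Sp.
rewrite -(mulr0 (a ^+ d)) -(Sx p Sp) -dhomog_meval //.
by apply: meval_eq => j; rewrite mxE.
Qed.

(** The hypothesis concerns closed sets cut out by homogeneous equations only, so [f] and [g] are
    split into homogeneous parts. If [f * g] vanishes on the cone, then along each line of it the
    restriction of [f] or that of [g] is the zero polynomial, that is, all parts of one of them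
    vanish there. *)
Lemma proj_irreducible_set m (Z : pset K m) :
  proj_irreducible Z -> irreducible m (rvset Z).
Proof.
case=> cZ [v0 Zv0] irrZ; split; first by exists (\row_i v0 i); apply/rvset_row.
move=> f g xf xg Zf Zg; apply: NNPP => nfg.
have [p Ep] := polyfun_mpoly xf; have [q Eq] := polyfun_mpoly xg.
pose parts (r : {mpoly K[m]}) s := exists2 d : nat, (d < msize r)%N & s = pihomog mdeg d r.
have cl r : zclosed (zero_locus (parts r)).
  exists (parts r); split=> // s [d _ ->]; exists d; exact: pihomogP.
pose P (r : {mpoly K[m]}) (x : 'rV[K]_m) :=
  \poly_(d < msize r) (pihomog mdeg d r).@[fun i => x 0 i].
have EP r x a : (P r x).[a] = r.@[fun i => (a *: x) 0 i].
  rewrite horner_poly [in RHS](pihomog_partitionE (leqnn (msize r))) raddf_sum /=.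
  apply: eq_bigr => d _; rewrite mulrC -dhomog_meval; last exact: pihomogP.
  by apply: meval_eq => i; rewrite mxE.
have parts0 (r : {mpoly K[m]}) x : rvset Z x -> P r x = 0 -> zero_locus (parts r) (fun i => x 0 i).
  move=> Zx Pr0; split; first by case: cZ => S [_ ZS]; case/ZS: Zx.
  move=> s [d dr ->]; have := congr1 (fun s : {poly K} => s`_d) Pr0.
  by rewrite coef_poly dr coef0.
have parts_eval (r : {mpoly K[m]}) x : zero_locus (parts r) (fun i => x 0 i) ->
    r.@[fun i => x 0 i] = 0.
  case=> _ r0; rewrite (pihomog_partitionE (leqnn (msize r))) raddf_sum big1 // => d _.
  by apply: r0; exists d.
have cov : psubset Z (fun v => zero_locus (parts p) v \/ zero_locus (parts q) v).
  move=> v Zv; pose x : 'rV[K]_m := \row_i v i.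
  have Zx : rvset Z x by apply/rvset_row.
  (* The factor ['X] takes care of [a = 0], where [a *: x] is the zero vector and leaves [Z]. *)
  have PQ0 : P p x * P q x * 'X = 0.
    apply: poly_eq0_horner => a; rewrite !hornerM hornerX.
    have [->|a0] := eqVneq a 0; first by rewrite mulr0.
    apply/eqP; rewrite mulf_eq0 (negPf a0) orbF; apply/negP => /negP fg0; apply: nfg.
    by exists (a *: x); [apply: zclosed_cone | rewrite Ep Eq -!EP].
  have ext r : zero_locus (parts r) (fun i => x 0 i) -> zero_locus (parts r) v.
    by apply: zclosed_ext => // i; rewrite mxE.
  move/eqP: PQ0; rewrite mulf_eq0 polyX_eq0 orbF mulf_eq0 => /orP[] /eqP H.
    by left; apply/ext/parts0.
  by right; apply/ext/parts0.
case: (irrZ _ _ (cl p) (cl q) cov) => sub.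
  by case: Zf => x /sub/parts_eval; rewrite Ep => ->; rewrite eqxx.
by case: Zg => x /sub/parts_eval; rewrite Eq => ->; rewrite eqxx.
Qed.

Lemma polyfun_linear m (v : 'cV[K]_m) : mxpoly 1 m (fun x => (x *m v) 0 0).
Proof. by apply: polymapM; [exact: polymap_id | exact: polymap_const]. Qed.

Lemma proj_irreducible_variety m (Z : pset K m) : proj_irreducible Z -> variety (rvset Z).
Proof.
move=> irrZ; have irr := proj_irreducible_set irrZ; case: irrZ => cZ _ _.
split=> //; first by move=> a x; apply: zclosed_cone.
pose y k (x : 'rV[K]_m) := if insub k is Some i then x 0 i else 0.
have xy k : mxpoly 1 m (y k).
  rewrite /y; case: insub => [i|]; last exact: polyfun_const.
  exact: (polyfun_coord (@mxcoord K 1 m) (0, i)).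
have [Q [dQ gQ Qp]] := generic_equations irr xy m.
have yE (x : 'rV_m) : (fun i : 'I_m => y i x) =1 fun i => x 0 i.
  by move=> i; rewrite /y valK.
(* The origin may satisfy all the equations but is not a projective point, so it is excluded
   explicitly. *)
exists (fun x => Q x /\ ~ forall i, x 0 i = 0); split.
- apply: definable_and => //; apply/definable_not/definable_forall => i.
  by apply: definable_eq0; apply: (polyfun_coord (@mxcoord K 1 m) (0, i)).
- move=> x [Qx x0]; case: (cZ) => S [_ ZS]; apply/ZS; split.
    apply: NNPP => nx; apply: x0 => i; apply/eqP/negP => /negP xi.
    by apply: nx; exists i.
  move=> p Sp; rewrite -(meval_eq _ (yE x)); apply: Qp => // z /ZS[_ /(_ p Sp)].
  by rewrite -(meval_eq _ (yE z)).
apply: (generically_imp gQ) => z Zz Qz; split=> // z0.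
by case: cZ => S [_ ZS]; case/ZS: Zz => -[i]; rewrite z0 eqxx.
Qed.

Lemma proj_nondegenerate_spanning m (Z : pset K m) :
  zclosed Z -> proj_nondegenerate Z -> spanning (rvset Z).
Proof.
move=> cZ ndZ v v0; apply: NNPP => nv.
pose l : {mpoly K[m]} := \sum_i v i 0 *: 'X_i.
have El (x : 'I_m -> K) : l.@[x] = ((\row_i x i) *m v) 0 0.
  rewrite mxE raddf_sum; apply: eq_bigr => i _.
  by rewrite /= mevalZ mevalXU !mxE mulrC.
have l1 : l \is 1.-homog.
  by apply: rpred_sum => i _; apply: rpredZ; rewrite dhomogX /= mdeg1.
have l0 : l != 0.
  have [i vi] : exists i, v i 0 != 0.
    apply/existsP; rewrite -negb_forall; apply: contraNN v0 => /forallP v0.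
    by apply/eqP/colP => i; rewrite mxE; apply/eqP; apply: v0.
  apply: contraNneq vi => l0; have := El (fun j => (j == i)%:R).
  rewrite l0 meval0 => ->; rewrite mxE (bigD1 i) //= big1 => [|j ji].
    by rewrite !mxE eqxx mul1r addr0.
  by rewrite !mxE (negPf ji) mul0r.
apply: (ndZ l l1 l0) => w Zw; have Zx := (rvset_row w cZ).2 Zw.
split; first by case: cZ => S [_ ZS]; case/ZS: Zw.
move=> p ->; rewrite El; apply/eqP/negP => /negP lw; apply: nv.
by exists (\row_i w i).
Qed.

Lemma variety_setT m : variety (fun _ : 'rV[K]_m => True).
Proof.
split=> //; first exact: irreducible_setT.
exists (fun=> True); split=> //; first exact: definable_true.
exact: (generically_true (irreducible_setT K 1 m)).
Qed.

Lemma spanning_setT m : spanning (fun _ : 'rV[K]_m => True).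
Proof.
move=> v v0; apply: NNPP => nv; case/eqP: v0; apply/colP => i; rewrite mxE.
apply/eqP/negP => /negP vi; apply: nv; exists (delta_mx 0 i) => //.
by rewrite -rowE mxE.
Qed.
End Varieties.

(** * Dominant projections as a measure of dimension *)

Section Dimension.
Variable K : closedFieldType.
Notation mxpoly s m := (polyfun (@mxcoord K s m)).
Notation irreducible m := (irreducible_set (@mxcoord K 1 m)).

Lemma definable_eqmx I T (x : I -> T -> K) s m (f g : T -> 'M[K]_(s, m)) :
  polymap x f -> polymap x g -> definable x (fun t => f t = g t).
Proof.
move=> xf xg.
have H : definable x (fun t => forall i j, f t i j - g t i j = 0).
  apply: definable_forall => i; apply: definable_forall => j.
  by apply: definable_eq0; apply: polyfunB.
apply: definable_ext H => t; split=> [fg|-> i j]; last by rewrite subrr.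
by apply/matrixP => i j; apply/eqP; rewrite -subr_eq0 fg.
Qed.

Section Ext.
Variables (I T : Type) (x : I -> T -> K) (s m : nat).
Let ext := @extcoord K I T x s m.

Lemma polyfun_ext_fst f : polyfun x f -> polyfun ext (fun z => f z.1).
Proof. by apply: polyfun_comp => i; apply: (polyfun_coord ext (inl i)). Qed.

Lemma polymap_ext_fst a b (f : T -> 'M[K]_(a, b)) :
  polymap x f -> polymap ext (fun z => f z.1).
Proof. by move=> xf i j; apply: (polyfun_ext_fst (xf i j)). Qed.

Lemma polymap_ext_snd : polymap ext (fun z => z.2).
Proof. by move=> i j; apply: (polyfun_coord ext (inr (i, j))). Qed.

Lemma definable_mxsub a b (P : 'M[K]_(a, b) -> Prop) phi :
  polymap x phi -> definable (@mxcoord K a b) P -> definable x (fun t => P (phi t)).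
Proof. by move=> xphi; apply: definable_sub => -[i j]; apply: xphi. Qed.
End Ext.

(** This says that [phi] is dominant on [X], or that its components are algebraically independent as
    functions on [X]. *)
Definition dense m d (X : 'rV[K]_m -> Prop) (phi : 'rV[K]_m -> 'rV[K]_d) :=
  forall r, mxpoly 1 d r -> (forall x, X x -> r (phi x) = 0) -> forall t, r t = 0.

Lemma not_dense m d (X : 'rV[K]_m -> Prop) (phi : 'rV[K]_m -> 'rV[K]_d) :
  ~ dense X phi -> exists r, [/\ mxpoly 1 d r, forall x, X x -> r (phi x) = 0
    & exists t, r t != 0].
Proof.
move=> nd; apply: NNPP => nr; apply: nd => r xr r0 t; apply/eqP/negP => /negP rt.
by apply: nr; exists r; split=> //; exists t.
Qed.

(** This replaces Chevalley's theorem on images. Being hit by a point of the model where [h] is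
    nonzero is definable in [t]; were its failure generic, the hypersurface [g = 0] would contain
    the images of the general points of [X], against density. *)
Lemma dense_lift m d (X : 'rV[K]_m -> Prop) (phi : 'rV[K]_m -> 'rV[K]_d) h :
  variety X -> polymap (@mxcoord K 1 m) phi -> dense X phi ->
  mxpoly 1 m h -> meets X h ->
  generically (@mxcoord K 1 d) (fun=> True) (fun t => exists2 x, X x & h x != 0 /\ phi x = t).
Proof.
case=> irrX _ [Xo [dXo XoX [ho [xho Xho hoXo]]]] xphi dX xh Xh.
pose P (t : 'rV[K]_d) (x : 'rV[K]_m) := Xo x /\ (h x != 0 /\ phi x = t).
have dP : definable (@mxcoord K 1 d) (fun t => exists x, P t x).
  apply: definable_ex; have snd := @polymap_ext_snd _ _ (@mxcoord K 1 d) 1 m.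
  apply: definable_and; first exact: (definable_mxsub snd).
  apply: definable_and; first by apply: definable_neq0; apply: (polyfun_mxcomp snd).
  apply: definable_eqmx; last exact: (@polymap_ext_fst _ _ _ _ _ _ _ id (@polymap_id K 1 d)).
  by move=> i j; apply: (polyfun_mxcomp snd (xphi i j)).
have irrT := irreducible_setT K 1 d.
case: (definable_dichotomy irrT dP) => gP; apply: (generically_imp gP) => t _.
  by case=> x [/XoX Xx hx]; exists x.
move=> _; exfalso; case: gP => g [xg [t0 _ gt0] gP].
have [gX|gX] := vanishes_or_meets X (fun x => g (phi x)).
  by rewrite (dX g xg gX) eqxx in gt0.
have [x Xx] := irrX.2 _ _ (polyfunM xh xho) (polyfun_mxcomp xphi xg)
  (irrX.2 _ _ xh xho Xh Xho) gX.
rewrite !mulf_eq0 => /norP[/norP[hx hox] gx].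
by case: (gP (phi x) I gx); exists x; split; [apply: hoXo | ].
Qed.

Lemma polymap_mulmxr m d (M : 'M[K]_(m, d)) : polymap (@mxcoord K 1 m) (fun x => x *m M).
Proof. by apply: polymapM; [apply: polymap_id | apply: polymap_const]. Qed.

(** This reconciles two orders of variables: the distinguished coordinate [a] comes first in
    [row_mx a%:M t] but has the last index, [d], in [eval2]. *)
Definition glue d (t : 'rV[K]_d) (a : K) (k : nat) : K :=
  if insub k is Some i then t 0 i else a.

Lemma glue_max d t a : @glue d t a d = a.
Proof. by rewrite /glue insubF // ltnn. Qed.

Lemma glue_meval d t a (c : {mpoly K[d]}) :
  c.@[fun i : 'I_d => @glue d t a i] = c.@[fun i => t 0 i].
Proof. by apply: meval_eq => i; rewrite /glue valK. Qed.

Lemma polyfun_glue d g : mxpoly 1 (1 + d) g ->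
  exists P : {poly {mpoly K[d]}}, forall (t : 'rV[K]_d) a,
    g (row_mx a%:M t) = eval2 (glue t a) P.
Proof.
elim=> [[i j]|a|f h _ [p Ep] _ [q Eq]|f h _ [p Ep] _ [q Eq]|f h fh _ [p Ep]].
- rewrite /mxcoord /= ord1; case: (split_ordP j) => k ->.
    exists 'X => t a; rewrite row_mxEl eval2X glue_max ord1.
    by rewrite mxE eqxx.
  by exists ('X_k)%:P => t a; rewrite row_mxEr eval2C mevalXU /glue valK.
- by exists (a%:MP)%:P => t b; rewrite eval2C mevalC.
- by exists (p + q) => t a; rewrite eval2D Ep Eq.
- by exists (p * q) => t a; rewrite eval2M Ep Eq.
by exists p => t a; rewrite -fh.
Qed.

Lemma finite_root_vectors m (p : 'I_m -> {poly K}) : (forall i, p i != 0) ->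
  exists L : seq 'rV[K]_m, forall x : 'rV_m, (forall i, root (p i) (x 0 i)) -> x \in L.
Proof.
move=> p0.
have nf i : exists r : seq K, p i = lead_coef (p i) *: \prod_(z <- r) ('X - z%:P).
  by case: (closed_field_poly_normal (p i)) => r; exists r.
have {nf} [rs Ers] := fin_all_exists nf.
pose N := \max_i size (rs i).
exists [seq \row_i (rs i)`_(phi i) | phi : {ffun 'I_m -> 'I_N}] => x px.
have xrs i : x 0 i \in rs i.
  have := px i; rewrite Ers rootZ ?lead_coef_eq0 //.
  by rewrite root_prod_XsubC.
have lt i : (index (x 0%R i) (rs i) < N)%N.
  by apply: leq_trans (leq_bigmax i); rewrite index_mem.
apply/mapP; exists [ffun i => Ordinal (lt i)]; first by rewrite mem_enum.
by apply/rowP => i; rewrite mxE ffunE /= nth_index.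
Qed.

Lemma row_mx_scalar d (y : 'rV[K]_(1 + d)) : y = row_mx (y 0 0)%:M (rsubmx y).
Proof.
rewrite -[LHS]hsubmxK; congr row_mx; apply/rowP => i; rewrite ord1 !mxE eqxx.
by congr (y _ _); apply/val_inj.
Qed.

Lemma polymap_row_mx I T (x : I -> T -> K) d (f : T -> K) (g : T -> 'rV[K]_d) :
  polyfun x f -> polymap x g -> polymap x (fun t => row_mx (f t)%:M (g t)).
Proof.
move=> xf xg i j; case: (split_ordP j) => k ->.
  by apply: polyfun_ext xf => t; rewrite row_mxEl !ord1 mxE eqxx.
by apply: polyfun_ext (xg i k) => t; rewrite row_mxEr.
Qed.

(* If no coordinate enlarges the projection [M], its general fibres on [X'] are
   finite, so [f] satisfies a relation over the base; the constant term of a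
   shortest one vanishes on [X], although [M] is dominant there. *)
Lemma dense_step m d (X X' : 'rV[K]_m -> Prop) (f : 'rV_m -> K) (M : 'M[K]_(m, d)) :
  variety X' -> (forall x, X x -> X' x) -> mxpoly 1 m f -> (forall x, X x -> f x = 0) ->
  meets X' f -> dense X (fun x => x *m M) ->
  exists M' : 'M_(m, 1 + d), dense X' (fun x => x *m M').
Proof.
move=> vX' XX' xf f0 X'f dXM; apply: NNPP => nM'.
have irr := variety_irreducible vX'.
have xM := polymap_mulmxr M.
pose phi x := row_mx (f x)%:M (x *m M).
have xphi : polymap (@mxcoord K 1 m) phi by apply: polymap_row_mx.
(* If [phi] were dominant, a general fibre of [M] on [X'] would carry infinitely many values of [f],
   although the relations [r i] leave only finitely many points in it. *)
have [dphi|/not_dense[r [xr r0 [y ry]]]] := classic (dense X' phi).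
  have ri i : exists r, [/\ mxpoly 1 (1 + d) r,
      forall x, X' x -> r (row_mx (x 0 i)%:M (x *m M)) = 0 & exists t, r t != 0].
    have : ~ dense X' (fun x => x *m row_mx (delta_mx i 0 : 'cV_m) M).
      by move=> H; by case: nM'; exists (row_mx (delta_mx i 0 : 'cV_m) M).
    move/not_dense => [r [xr r0 rt]]; exists r; split=> // x X'x.
    rewrite -(r0 x X'x) mul_mx_row; congr (r (row_mx _ _)).
    by apply/rowP => k; rewrite !ord1 -colE !mxE eqxx.
  have {ri} [r Er] := fin_all_exists ri.
  have [g [xg [y _ gy] gP]] := dense_lift vX' xphi dphi (polyfun_const _ 1)
     (let: ex_intro2 x Xx _ := X'f in ex_intro2 _ _ x Xx (oner_neq0 K)).
  have xrow a : polymap (@mxcoord K 1 d) (fun t => row_mx a%:M t).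
    by apply: polymap_row_mx; [apply: polyfun_const | apply: polymap_id].
  have irrT := irreducible_setT K 1 d.
  have gen h : mxpoly 1 (1 + d) h -> (exists y, h y != 0) ->
      generically (@mxcoord K 1 d) (fun=> True) (fun t => exists a, h (row_mx a%:M t) != 0).
    move=> xh [z hz]; exists (fun t => h (row_mx (z 0 0)%:M t)); split.
    - exact: (polyfun_mxcomp (xrow _) xh).
    - by exists (rsubmx z) => //; rewrite -row_mx_scalar.
    - by move=> t _ ht; exists (z 0 0).
  have gr i : generically (@mxcoord K 1 d) (fun=> True)
      (fun t => exists a, r i (row_mx a%:M t) != 0).
    by case: (Er i) => xri _; apply: gen.
  have [t _ [[a ga] rt]] := generically_ex (generically_and irrT
    (gen g xg (ex_intro _ y gy)) (generically_forall irrT gr)).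
  have pol h : mxpoly 1 (1 + d) h -> (exists a, h (row_mx a%:M t) != 0) ->
      exists2 p : {poly K}, p != 0 & forall a, h (row_mx a%:M t) = p.[a].
    move=> xh [b hb].
    have [p Ep] := polyfun_mxline (row_mx 0 t) (row_mx 1%:M 0) xh.
    have E c : h (row_mx c%:M t) = p.[c].
      rewrite -Ep; congr h; rewrite scale_row_mx scaler0 add_row_mx add0r addr0.
      by rewrite scale_scalar_mx mulr1.
    by exists p => //; apply: contraNneq hb => p0; rewrite E p0 horner0.
  have [p p0 Ep] := pol g xg (ex_intro _ a ga).
  have pi i : exists q : {poly K}, q != 0 /\ forall a, r i (row_mx a%:M t) = q.[a].
    by case: (Er i) => xri _ _; have [q] := pol (r i) xri (rt i); exists q.
  have [q Eq] := fin_all_exists pi.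
  have [L EL] := finite_root_vectors (fun i => (Eq i).1).
  (* The value [b] is general enough for [(b, t)] to be lifted to [X'], yet differs from all values
     of [f] on the finite list [L]. *)
  have [b] : exists b, (p * \prod_(x <- L) ('X - (f x)%:P)).[b] != 0.
    apply: poly_nonroot; rewrite mulf_neq0 // prodf_seq_neq0.
    by apply/allP => x _; rewrite /= polyXsubC_eq0.
  rewrite hornerM mulf_eq0 => /norP[pb Lb].
  have := gP (row_mx b%:M t) I; rewrite Ep => /(_ pb)[x X'x [_ Ex]].
  move/eq_row_mx: Ex => [/rowP/(_ 0)]; rewrite !mxE eqxx !mulr1n => fx xt.
  case/negP: Lb; rewrite horner_prod prodf_seq_eq0; apply/hasP; exists x.
    apply: EL => i; apply/rootP; rewrite -(Eq i).2 -xt.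
    by case: (Er i) => _ -> .
  by rewrite /= !hornerE fx subrr.
pose ok n := exists P : {poly {mpoly K[d]}}, [/\ size P = n,
  forall x, X' x -> eval2 (glue (x *m M) (f x)) P = 0
  & exists (t : 'rV[K]_d) a, eval2 (glue t a) P != 0].
have : exists n, ok n.
  have [P EP] := polyfun_glue xr; exists (size P), P; split=> //.
    by move=> x /r0; rewrite /phi EP.
  by exists (rsubmx y), (y 0 0); rewrite -EP -row_mx_scalar.
case/classical_least => n [P [Pn XP [t [a Pta]]]] minn.
have P00 (u : 'rV[K]_d) : (P`_0).@[fun i => u 0 i] = 0.
  move: u; apply: (dXM (fun u : 'rV_d => (P`_0).@[fun i => u 0 i])).
    by apply: polyfun_meval => j; apply: (polyfun_coord (@mxcoord K 1 d) (0, j)).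
  move=> x Xx; have := XP x (XX' x Xx); rewrite f0 //.
  by rewrite /eval2 glue_max horner_coef0 coef_map /= glue_meval.
pose Q := \poly_(k < n.-1) P`_k.+1.
have EQ (u : 'rV[K]_d) b : eval2 (glue u b) P = b * eval2 (glue u b) Q.
  have -> : P = (P`_0)%:P + Q * 'X.
    apply/polyP => -[|k]; rewrite coefD coefC coefMX /= ?addr0 // add0r coef_poly.
    case: ltnP => // nk; rewrite nth_default // Pn -ltnS; case: n {Pn minn Q} nk => //.
  by rewrite eval2D eval2C eval2M eval2X glue_max glue_meval P00 add0r mulrC.
have n0 : (0 < n)%N.
  by rewrite -Pn size_poly_gt0; apply: contraNneq Pta => ->; rewrite /eval2 map_poly0 horner0.
have sQ : (size Q < n)%N by rewrite -[n in (_ < n)%N]prednK // ltnS size_poly.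
apply: (minn _ sQ); exists Q; split=> //; last first.
  by exists t, a; apply: contraNneq Pta => H; rewrite EQ H mulr0.
have xQ : mxpoly 1 m (fun x => eval2 (glue (x *m M) (f x)) Q).
  apply: (@polyfun_eval2 _ _ _ _ (fun k x => glue (x *m M) (f x) k)) => k.
  by rewrite /glue; case: insub => [i|] //; apply: xM.
apply: (vanishesM irr xf xQ X'f) => x X'x.
by rewrite -EQ XP.
Qed.
End Dimension.

Section DimGe.
Variable K : closedFieldType.
Notation mxpoly s m := (polyfun (@mxcoord K s m)).

Lemma dense_sub m d (X X' : 'rV[K]_m -> Prop) (phi : 'rV[K]_m -> 'rV[K]_d) :
  (forall x, X x -> X' x) -> dense X phi -> dense X' phi.
Proof. by move=> XX' dX r xr r0; apply: dX => // x /XX'; apply: r0. Qed.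

Lemma zclosed_separate m (Z Z' : pset K m) : zclosed Z -> zclosed Z' ->
  ~ psubset Z' Z -> exists p : {mpoly K[m]}, [/\ homogeneous p,
    forall x, rvset Z x -> p.@[fun i => x 0 i] = 0 &
    meets (rvset Z') (fun x => p.@[fun i => x 0 i])].
Proof.
case=> S [Shom ZS] cZ' nsub; apply: NNPP => np; apply: nsub => v Z'v; apply/ZS.
split; first by case: cZ' => S' [_ ZS']; case/ZS': Z'v.
move=> p Sp; apply/eqP/negP => /negP pv; apply: np; exists p; split; first exact: Shom.
  by move=> x /ZS[_]; apply.
exists (\row_i v i); first exact/rvset_row.
by rewrite (meval_eq (v2 := v)) // => i; rewrite mxE.
Qed.

Lemma polyfun_rvmeval m (p : {mpoly K[m]}) : mxpoly 1 m (fun x => p.@[fun i => x 0 i]).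
Proof. by apply: polyfun_meval => i; apply: (polyfun_coord (@mxcoord K 1 m) (0, i)). Qed.

(** A point of projective space is a line in the cone, which accounts for the first coordinate; each
    strict inclusion in the chain adds one by [dense_step], applied to an equation of the smaller
    set that does not vanish on the larger. *)
Lemma dim_ge_dense m (Z : pset K m) n : dim_ge Z n ->
  exists M : 'M_(m, n.+1), dense (rvset Z) (fun x => x *m M).
Proof.
case=> C [irrC ltC subC].
suff H j : (j <= n)%N -> exists M : 'M_(m, j.+1), dense (rvset (C j)) (fun x => x *m M).
  by have [M dM] := H n (leqnn n); exists M; apply: dense_sub dM => x /subC.
elim: j => [_|j IH jn].
  have [cC [v Cv] _] := irrC 0 (leq0n n).
  have [i vi] : nonzero_vec v by case: (cC) => S [_ CS]; case/CS: Cv.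
  exists (delta_mx i 0) => r xr r0 t.
  have [p Ep] := polyfun_mxline 0 1%:M xr.
  have Et (u : 'rV_1) : r u = p.[u 0 0].
    by rewrite -Ep; congr r; apply/rowP => k; rewrite !ord1 !mxE eqxx mulr1 add0r.
  suff /eqP : p * 'X = 0 by rewrite mulf_eq0 polyX_eq0 orbF Et => /eqP->; rewrite horner0.
  apply: poly_eq0_horner => a; rewrite hornerM hornerX.
  have [->|a0] := eqVneq a 0; first by rewrite mulr0.
  have Cx := zclosed_cone cC (mulf_neq0 a0 (invr_neq0 vi)) ((rvset_row v cC).2 Cv).
  have := r0 _ Cx; rewrite Et -colE !mxE divfK // => ->.
  by rewrite mul0r.
have [M dM] := IH (ltnW jn).
have [cC _ _] := irrC j (ltnW jn); have [cC' _ _] := irrC j.+1 jn.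
have [sub nsub] := ltC j jn.
have [p [_ p0 pC']] := zclosed_separate cC cC' nsub.
apply: dense_step (proj_irreducible_variety (irrC j.+1 jn)) _ (polyfun_rvmeval p) p0 pC' dM.
by move=> x; apply: sub.
Qed.

(** * Projection from general points *)

Lemma base_digits_inj n (a b : nat -> nat) B :
  (forall i, (a i < B)%N) -> (forall i, (b i < B)%N) ->
  (\sum_(i < n) a i * B ^ i = \sum_(i < n) b i * B ^ i)%N ->
  forall i, (i < n)%N -> a i = b i.
Proof.
elim: n a b => // n IH a b aB bB.
have E (f : nat -> nat) : (\sum_(i < n.+1) f i * B ^ i =
    (\sum_(i < n) f i.+1 * B ^ i) * B + f 0)%N.
  rewrite big_ord_recl expn0 muln1 addnC big_distrl /=; congr addn.
  by apply: eq_bigr => i _; rewrite expnSr mulnA.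
rewrite !E => Eab.
have B0 : (0 < B)%N by apply: leq_ltn_trans (aB 0).
have E0 : a 0 = b 0.
  by have := congr1 (modn^~ B) Eab; rewrite /= !modnMDl !modn_small.
move/eqP: Eab; rewrite E0 eqn_add2r eqn_pmul2r // => /eqP Eab [|i] //.
by apply: (IH (fun i => a i.+1) (fun i => b i.+1)).
Qed.

(** Kronecker substitution: with [B] above all exponents, setting variable [i] to [a ^+ (B ^ i)]
    sends distinct monomials to distinct powers of [a]. *)
Lemma mpoly_neq0_meval n (p : {mpoly K[n]}) : p != 0 ->
  exists t : 'rV_n, p.@[fun i => t 0 i] != 0.
Proof.
move=> p0; pose B := (msize p).+1.
pose e (m : 'X_{1..n}) := (\sum_(i < n) m i * B ^ i)%N.
pose q : {poly K} := \sum_(m <- msupp p) p@_m *: 'X^(e m).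
have lt m i : m \in msupp p -> (m i < B)%N.
  move=> /msize_mdeg_lt mp; rewrite ltnS; apply: leq_trans (ltnW mp).
  by rewrite mdegE (bigD1 i) //= leq_addr.
have einj : {in msupp p &, injective e}.
  move=> m1 m2 m1p m2p Em; apply/mnmP => i.
  pose a (m : 'X_{1..n}) k := if insub k is Some i then m i else 0.
  have aE m (j : 'I_n) : a m j = m j by rewrite /a valK.
  have aB m k : m \in msupp p -> (a m k < B)%N.
    by move=> mp; rewrite /a; case: insub => // j; apply: lt.
  have Ea m : e m = (\sum_(i < n) a m i * B ^ i)%N.
    by apply: eq_bigr => j _; rewrite aE.
  rewrite -!aE; apply: (base_digits_inj (n := n) (B := B)) => //.
  - by move=> k; apply: aB.
  - by move=> k; apply: aB.
  - by rewrite -!Ea.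
have q0 : q != 0.
  have mp := mlead_supp p0; rewrite mcoeff_msupp in mp.
  apply: contraNneq mp => q0; have := congr1 (fun r : {poly K} => r`_(e (mlead p))) q0.
  rewrite coef0 coef_sum (bigD1_seq (mlead p)) ?msupp_uniq ?mlead_supp //=.
  rewrite coefZ coefXn eqxx mulr1 big_seq_cond big1 ?addr0 => [->//|m /andP[mp mne]].
  rewrite coefZ coefXn; case: eqP => [/esym Em|]; rewrite ?mulr0 //.
  by case/eqP: mne; apply: einj => //; apply: mlead_supp.
have [a qa] := poly_nonroot q0; exists (\row_i a ^+ (B ^ i)).
rewrite (meval_eq (v2 := fun i => a ^+ (B ^ i))); last by move=> i; rewrite mxE.
rewrite mevalE; move: qa; rewrite horner_sum; congr (_ != 0).
apply: eq_bigr => m _; rewrite hornerZ hornerXn; congr (_ * _).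
by rewrite -prodrXr; apply: eq_bigr => i _; rewrite -exprM mulnC.
Qed.

Lemma row_free_col_mx m j (u : 'rV[K]_m) (B : 'M_(j, m)) :
  row_free B -> ~~ (u <= B)%MS -> row_free (col_mx u B).
Proof.
move=> fB uB; suff lt : (j < \rank (u + B)%MS)%N.
  by move: lt; rewrite addsmxE /row_free => lt; rewrite eqn_leq rank_leq_row.
rewrite -{1}(eqP fB) ltn_neqAle mxrankS ?addsmxSr // andbT.
apply: contraNneq uB => rE; apply: submx_trans (addsmxSl u B) _.
by rewrite -(mxrank_leqif_sup (addsmxSr u B)) rE.
Qed.

Lemma spanning_basis m (S : 'rV[K]_m -> Prop) : spanning S ->
  exists2 B : 'M[K]_m, B \in unitmx & forall i, S (row i B).
Proof.
move=> spS.
suff H j : (j <= m)%N -> exists2 B : 'M[K]_(j, m), row_free B & forall i, S (row i B).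
  have [B fB SB] := H m (leqnn m); exists B => //.
  by rewrite -row_free_unit.
elim: j => [_|j IH jm]; first by exists 0 => [|[]] //; rewrite /row_free mxrank0.
have [B fB SB] := IH (ltnW jm).
have [v v0 Bv] : exists2 v : 'cV[K]_m, v != 0 & B *m v = 0.
  have : cokermx B != 0.
    by rewrite -mxrank_eq0 mxrank_coker (eqP fB) subn_eq0 -ltnNge.
  case/matrix0Pn => i [k ck]; exists (col k (cokermx B)); last by rewrite colE mulmxA mulmx_coker mul0mx.
  by apply: contraNneq ck => /colP/(_ i); rewrite !mxE => ->.
have [u Su uv] := spS v v0; exists (col_mx u B).
  apply: row_free_col_mx => //; apply: contraNN uv => /submxP[D ->].
  by rewrite -mulmxA Bv mulmx0 mxE.
move=> i; case: (split_ordP (i : 'I_(1 + j))) => k ->.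
  by rewrite (rowKu k u B) ord1 row_id.
by rewrite (rowKd k u B).
Qed.
End DimGe.

Section Projection.
Variable K : closedFieldType.
Notation mxpoly s m := (polyfun (@mxcoord K s m)).

Lemma dense_full m d e (X : 'rV[K]_m -> Prop) (N : 'M_(m, d)) (A : 'M[K]_(d, e)) :
  row_full A -> dense X (fun x => x *m N) -> dense X (fun x => x *m (N *m A)).
Proof.
move=> fA dN r xr r0 t; rewrite -(mulmxKpV (submx_full t fA)).
apply: (dN (fun y => r (y *m A))) => [|x Xx]; first exact: (polyfun_mxcomp (polymap_mulmxr A)).
by rewrite -mulmxA r0.
Qed.

Definition rel_eval d (y : 'rV[K]_(1 + d)) (P : {poly {mpoly K[d]}}) :=
  eval2 (glue (rsubmx y) (y 0 0)) P.

Definition coef_eval d (y : 'rV[K]_(1 + d)) (c : {mpoly K[d]}) :=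
  c.@[fun i => rsubmx y 0 i].

Section GoodDirections.
Variables (m d : nat) (X : 'rV[K]_m -> Prop).
Hypothesis vX : variety X.
Variable N : 'M[K]_(m, 1 + d).
Hypothesis fN : row_full N.
Hypothesis dM : dense X (fun x => x *m rsubmx N).

Let irrX := variety_irreducible vX.
Let vanishes P := forall x, X x -> rel_eval (x *m N) P = 0.

Lemma rsubmx_mulmx (x : 'rV_m) : rsubmx (x *m N) = x *m rsubmx N.
Proof. by apply/matrixP=> i j; rewrite !mxE; apply: eq_bigr => k _; rewrite !mxE. Qed.

Lemma polyfun_rel_eval P : mxpoly 1 (1 + d) (fun y : 'rV[K]_(1 + d) => rel_eval y P).
Proof.
apply: (@polyfun_eval2 _ _ _ _ (fun k (y : 'rV_(1 + d)) => glue (rsubmx y) (y 0 0) k)) => k.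
rewrite /glue; case: insub => [i|].
  by apply: polyfun_ext (polyfun_coord (@mxcoord K 1 (1 + d)) (0, rshift 1 i)) => y; rewrite /mxcoord !mxE.
exact: (polyfun_coord (@mxcoord K 1 (1 + d)) (0, 0)).
Qed.

Lemma polyfun_coef_eval c : mxpoly 1 (1 + d) (fun y : 'rV[K]_(1 + d) => coef_eval y c).
Proof.
apply: polyfun_meval => i.
by apply: polyfun_ext (polyfun_coord (@mxcoord K 1 (1 + d)) (0, rshift 1 i)) => y; rewrite /mxcoord !mxE.
Qed.

Lemma rel_evalZ c P (y : 'rV[K]_(1 + d)) : rel_eval y (c *: P) = coef_eval y c * rel_eval y P.
Proof. by rewrite /rel_eval eval2Z glue_meval. Qed.

Lemma coef_evalX c e (y : 'rV[K]_(1 + d)) : coef_eval y (c ^+ e) = coef_eval y c ^+ e.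
Proof. by rewrite /coef_eval rmorphXn. Qed.

Lemma rel_evalX P e (y : 'rV[K]_(1 + d)) : rel_eval y (P ^+ e) = rel_eval y P ^+ e.
Proof.
elim: e => [|e IH]; last by rewrite !exprS -IH /rel_eval eval2M.
by rewrite !expr0 -[1]/(1%:P) /rel_eval eval2C meval1.
Qed.

Lemma polyfun_mulmxr g : mxpoly 1 (1 + d) g -> mxpoly 1 m (fun x => g (x *m N)).
Proof. exact: (polyfun_mxcomp (polymap_mulmxr N)). Qed.

Lemma polyfun_addr v g : mxpoly 1 (1 + d) g -> mxpoly 1 (1 + d) (fun y => g (y + v)).
Proof.
by apply: polyfun_mxcomp; apply: polymapD; [apply: polymap_id | apply: polymap_const].
Qed.

Lemma polyfun_rel_evalP g : mxpoly 1 (1 + d) g -> exists P, forall y, g y = rel_eval y P.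
Proof. by case/polyfun_glue=> P EP; exists P => y; rewrite [in LHS](row_mx_scalar y) EP. Qed.

Lemma coef_eval_meets c : c != 0 -> meets X (fun x => coef_eval (x *m N) c).
Proof.
move/mpoly_neq0_meval => [t ct]; apply: NNPP => nc; case/eqP: ct.
apply: (dM (r := fun t => c.@[fun i => t 0 i])); first exact: polyfun_rvmeval.
move=> x Xx; apply/eqP/negP => /negP cx; apply: nc; exists x => //.
by rewrite /coef_eval rsubmx_mulmx.
Qed.

Variable P : {poly {mpoly K[d]}}.
Hypotheses (P0 : P != 0) (XP : vanishes P).
Hypothesis minP : forall Q, Q != 0 -> vanishes Q -> (size P <= size Q)%N.

Let c := lead_coef P.
Let c0 : c != 0. Proof. by rewrite lead_coef_eq0. Qed.
Let Xc := coef_eval_meets c0.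

Lemma minimal_division Q : vanishes Q -> exists e S, c ^+ e *: Q = S * P.
Proof.
move=> XQ; exists (scalp Q P), (Q %/ P).
have E := Pdiv.Idomain.divp_eq Q P; rewrite [LHS]E.
suff -> : Q %% P = 0 by rewrite addr0.
apply/eqP/negP => /negP R0; have := minP R0; rewrite leqNgt ltn_modp P0 => H.
suff /H : vanishes (Q %% P) by [].
move=> x Xx; have := congr1 (rel_eval (x *m N)) E.
by rewrite rel_evalZ XQ // mulr0 /rel_eval eval2D eval2M -!/(rel_eval _ _) XP // mulr0 add0r.
Qed.

(* If all the sums [x + u] stay in the hypersurface [P = 0], then they stay in
   the closure of [X]: multiply by a power of the leading coefficient. *)
Lemma vanish_shift (S : 'rV_m -> Prop) g : variety S ->
  (forall x u, X x -> S u -> rel_eval (x *m N + u *m N) P = 0) ->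
  mxpoly 1 (1 + d) g -> (forall x, X x -> g (x *m N) = 0) ->
  forall x u, X x -> S u -> g (x *m N + u *m N) = 0.
Proof.
move=> vS XSP xg g0 x u Xx Su; move: x Xx.
have [Q EQ] := polyfun_rel_evalP xg.
have XQ : vanishes Q by move=> x Xx; rewrite -EQ g0.
have [e [R ER]] := minimal_division XQ.
apply: (vanishesM irrX (polyfun_mulmxr (polyfun_coef_eval c)) (polyfun_mulmxr (polyfun_addr _ xg)) Xc).
move=> x Xx /=; apply/eqP; rewrite mulf_eq0; apply/orP.
have [cx|cx] := eqVneq (coef_eval (x *m N) c) 0; [by left; apply/eqP | right].
have [p Ep] := polyfun_mxline (x *m N) (u *m N) (polyfun_coef_eval c).
have [q Eq] := polyfun_mxline (x *m N) (u *m N) xg.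
(* Along the line through [x *m N] in direction [u *m N], a power of [c] times [g] is a multiple of
   [P] and vanishes identically. Since [c] is nonzero at [a = 0], the factor [g] vanishes on the
   whole line, in particular at [a = 1]. *)
have : p ^+ e * q = 0.
  apply: poly_eq0_horner => a; rewrite hornerM horner_exp -Ep -Eq -coef_evalX EQ -rel_evalZ ER.
  rewrite /rel_eval eval2M -!/(rel_eval _ _).
  have [->|a0] := eqVneq a 0; first by rewrite scale0r addr0 XP // mulr0.
  by rewrite scalemxAl XSP ?mulr0 //; apply: variety_cone.
move/eqP; rewrite mulf_eq0 expf_eq0 => /orP[/andP[_ /eqP p0]|/eqP q0].
  by case/eqP: cx; have := Ep 0; rewrite scale0r addr0 p0 horner0.
by have := Eq 1; rewrite scale1r q0 horner0 => ->.
Qed.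

(** Otherwise the functions vanishing on the image of [X] would be stable under translation by every
    multiple of every point of [S]. As [S] contains a basis and [N] has full rank, [P] would vanish
    everywhere. *)
Lemma good_exists (S : 'rV_m -> Prop) : variety S -> spanning S ->
  exists x u, [/\ X x, S u & rel_eval (x *m N + u *m N) P != 0].
Proof.
move=> vS spS; apply: NNPP => ngood.
have XSP x u : X x -> S u -> rel_eval (x *m N + u *m N) P = 0.
  move=> Xx Su; apply/eqP/negP => /negP H; apply: ngood; by exists x, u.
have [B uB SB] := spanning_basis spS.
have step (a : 'I_m -> K) (r : seq 'I_m) g : mxpoly 1 (1 + d) g ->
    (forall x, X x -> g (x *m N) = 0) ->
    forall x, X x -> g (x *m N + \sum_(i <- r) (a i *: row i B) *m N) = 0.
  elim: r g => [|i r IH] g xg g0 x Xx; first by rewrite big_nil addr0 g0.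
  rewrite big_cons addrCA addrC.
  apply: (IH (fun y => g (y + (a i *: row i B) *m N))) => //; first exact: polyfun_addr.
  move=> z Xz; have [->|a0] := eqVneq (a i) 0; first by rewrite scale0r mul0mx addr0 g0.
  by apply: (vanish_shift vS XSP xg g0) => //; apply: variety_cone.
have [x Xx] := irrX.1.
have all0 (y : 'rV_(1 + d)) : rel_eval y P = 0.
  have := step (fun i => (((y - x *m N) *m pinvmx N) *m invmx B) 0 i) (enum 'I_m) _ (polyfun_rel_eval P) XP x Xx.
  suff -> : \sum_(i <- enum 'I_m) ((((y - x *m N) *m pinvmx N) *m invmx B) 0 i *: row i B) *m N
      = y - x *m N by rewrite addrC subrK.
  rewrite -mulmx_suml big_enum /= -mulmx_sum_row mulmxKV // mulmxKpV //.
  by rewrite submx_full.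
have [t ct] := mpoly_neq0_meval c0.
pose pt := map_poly (meval (fun i => t 0 i)) P.
have : pt = 0.
  apply: poly_eq0_horner => a; have := all0 (row_mx a%:M t).
  rewrite /rel_eval /eval2 row_mxKr mxE; case: split_ordP => // k; rewrite !ord1 => Ek.
  rewrite mxE eqxx mulr1n glue_max => <-; congr (_.[_]).
  by apply: eq_map_poly => b; rewrite glue_meval.
move/(congr1 (fun p : {poly K} => p`_(size P).-1)).
by rewrite coef0 coef_map /= => /eqP; rewrite (negPf ct).
Qed.

(** Up to powers of [c], a relation that vanishes on [X] is divisible by [P], with a shorter
    quotient; dividing repeatedly ends with a cofactor that no longer vanishes on [X]. *)
Lemma factor_power Q : Q != 0 -> exists e a R, c ^+ e *: Q = P ^+ a * R /\ ~ vanishes R.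
Proof.
have [n] := ubnP (size Q); elim: n Q => // n IH Q Qn Q0.
case: (classic (vanishes Q)) => [XQ|nQ]; last first.
  by exists 0, 0, Q; rewrite !expr0 scale1r mul1r.
have [e [S ES]] := minimal_division XQ.
have ce0 : c ^+ e != 0 by rewrite expf_neq0.
have S0 : S != 0.
  by apply: contraNneq Q0 => S0; move/eqP: ES; rewrite S0 mul0r -mul_polyC mulf_eq0 polyC_eq0 (negPf ce0).
have P2 : (1 < size P)%N.
  rewrite ltnNge; apply/negP => /size1_polyC EP.
  have [x Xx] := Xc; have := XP Xx; rewrite EP /rel_eval eval2C glue_meval => H.
  by rewrite /c EP lead_coefC /coef_eval H eqxx.
have sS : (size S < size Q)%N.
  have := congr1 (fun p : {poly {mpoly K[d]}} => size p) ES; rewrite size_scale // size_mul // => ->.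
  by rewrite -[in X in (_ < X)%N](ltn_predK P2) addnS /= -[X in (X < _)%N]addn0 ltn_add2l -ltnS (ltn_predK P2).
have [e' [a [R [ER nR]]]] := IH S (leq_trans sS Qn) S0.
exists (e' + e)%N, a.+1, R; split=> //.
by rewrite exprD -scalerA ES scalerAl ER exprSr -!mulrA [P * R]mulrC.
Qed.

(* If the projection from [u] is not dominant, some relation [R] is invariant
   under translation by [u]; then so is its factor [P], against the choice of [u]. *)
Lemma good_dense (x u : 'rV_m) (A : 'M_(1 + d, d)) : X x -> rel_eval (x *m N + u *m N) P != 0 ->
  u *m N *m A = 0 -> row_full A -> dense X (fun x => x *m (N *m A)).
Proof.
move=> Xx evu uA fA; apply: NNPP => /not_dense[r [xr r0 [t rt]]].
have [R ER] := polyfun_rel_evalP (polyfun_mxcomp (polymap_mulmxr A) xr).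
have R0 : R != 0.
  apply: contraNneq rt => R0; have := ER (t *m pinvmx A).
  by rewrite mulmxKpV ?submx_full // R0 /rel_eval /eval2 map_poly0 horner0 => ->.
have [e [a [Q [EQ nQ]]]] := factor_power R0.
have [y Xy /=] : meets X (fun x => rel_eval (x *m N) Q * rel_eval (x *m N + u *m N) P).
  apply: irrX.2; [exact: (polyfun_mulmxr (polyfun_rel_eval Q)) | | | by exists x].
    exact: (polyfun_mulmxr (polyfun_addr _ (polyfun_rel_eval P))).
  by case: (vanishes_or_meets X (fun x => rel_eval (x *m N) Q)).
rewrite mulf_eq0 => /norP[Qy Py].
have [p Ep] := polyfun_mxline (y *m N) (u *m N) (polyfun_rel_eval P).
have [q Eq] := polyfun_mxline (y *m N) (u *m N) (polyfun_rel_eval Q).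
(* [R] is constant along [u *m N] and vanishes at the image of [y], so [P ^+ a * Q] vanishes on that
   line. Neither factor can be zero: [P] is nonzero at parameter 1 and [Q] at parameter 0. *)
have : p ^+ a * q = 0.
  apply: poly_eq0_horner => b; rewrite hornerM horner_exp -Ep -Eq -rel_evalX.
  have := congr1 (rel_eval (y *m N + b *: (u *m N))) EQ; rewrite rel_evalZ /rel_eval eval2M -!/(rel_eval _ _) => <-.
  rewrite -ER mulmxDl -scalemxAl uA scaler0 addr0 -mulmxA r0 // mulr0 //.
move/eqP; rewrite mulf_eq0 expf_eq0 => /orP[/andP[_ /eqP p0]|/eqP q0].
  by case/eqP: Py; have := Ep 1; rewrite scale1r p0 horner0.
by case/eqP: Qy; have := Eq 0; rewrite scale0r addr0 q0 horner0.
Qed.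
End GoodDirections.

(** If the image of [X] under [N] is not dense, it lies in a hypersurface [P = 0]. Projection along
    [u *m N] stays dominant when translation by [u *m N] moves some point of the image off this
    hypersurface, that is, when the hypersurface is not a cylinder in that direction. *)
Lemma good_directions m d (X S : 'rV[K]_m -> Prop) (N : 'M_(m, 1 + d)) :
  variety X -> variety S -> spanning S -> row_full N ->
  dense X (fun x => x *m rsubmx N) ->
  exists G, [/\ mxpoly 1 m G, meets S G & forall u, G u != 0 -> forall A : 'M_(1 + d, d),
    u *m N *m A = 0 -> row_full A -> dense X (fun x => x *m (N *m A))].
Proof.
move=> vX vS spS fN dM.
have [dN|/not_dense[r [xr r0 [t rt]]]] := classic (dense X (fun x => x *m N)).
  exists (fun=> 1); split; [exact: polyfun_const | | by move=> u _ A _ fA; apply: dense_full].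
  by case: (variety_irreducible vS).1 => u Su; exists u; rewrite ?oner_neq0.
pose ok n := exists P : {poly {mpoly K[d]}}, [/\ size P = n, P != 0 & forall x, X x -> rel_eval (x *m N) P = 0].
have : exists n, ok n.
  have [P EP] := polyfun_glue xr; exists (size P), P; split=> //.
    apply: contraNneq rt => P0; rewrite [t]row_mx_scalar EP P0.
    by rewrite /eval2 map_poly0 horner0.
  by move=> x Xx; rewrite -(r0 x Xx) [in RHS](row_mx_scalar (x *m N)) EP.
case/classical_least => n [P [Pn P0 XP]] minn.
have minP (Q : {poly {mpoly K[d]}}) : Q != 0 -> (forall x, X x -> rel_eval (x *m N) Q = 0) -> (size P <= size Q)%N.
  move=> Q0 XQ; rewrite leqNgt; apply/negP; rewrite Pn => /minn; apply.
  by exists Q.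
have [x [u [Xx Su xu]]] := good_exists vX fN dM P0 XP minP vS spS.
exists (fun u => rel_eval (x *m N + u *m N) P); split; last 1 first.
- by move=> v xv A vA fA; apply: good_dense xv vA fA.
- apply: (@polyfun_eval2 _ _ _ _ (fun k u =>
    glue (rsubmx (x *m N + u *m N)) ((x *m N + u *m N) 0 0) k)) => k.
  have xN : polymap (@mxcoord K 1 m) (fun u => x *m N + u *m N).
    by apply: polymapD; [apply: polymap_const | apply: polymap_mulmxr].
  rewrite /glue; case: insub => [i|]; last exact: xN.
  by apply: polyfun_ext (xN 0 (rshift 1 i)) => v; rewrite [RHS]mxE.
- by exists u.
Qed.

Lemma dense_row_full m d (X : 'rV[K]_m -> Prop) (M : 'M_(m, d)) :
  dense X (fun x => x *m M) -> row_full M.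
Proof.
move=> dM; rewrite /row_full eqn_leq rank_leq_col leqNgt; apply/negP => lt.
have : cokermx M != 0 by rewrite -mxrank_eq0 mxrank_coker subn_eq0 -ltnNge.
case/matrix0Pn => i [k] /eqP; apply; pose v := col k (cokermx M).
have -> : cokermx M i k = ((delta_mx 0 i : 'rV_d) *m v) 0 0 by rewrite -rowE !mxE.
apply: (dM (fun t => (t *m v) 0 0)); first exact: polyfun_linear.
by move=> x _; rewrite -mulmxA /v colE [M *m _]mulmxA mulmx_coker mul0mx mulmx0 mxE.
Qed.

Lemma row_full_tr a b (A : 'M[K]_(a, b)) : row_full A = row_free A^T.
Proof. by rewrite /row_full /row_free mxrank_tr. Qed.

Lemma annihilating_column m a d (B : 'M[K]_(a, m)) (M : 'M_(m, d)) :
  row_full M -> (a + d < m)%N ->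
  exists2 w : 'cV_m, B *m w = 0 & row_full (row_mx w M).
Proof.
move=> fM lt; suff [k kM] : exists k, ~~ ((col k (cokermx B))^T <= M^T)%MS.
  exists (col k (cokermx B)); first by rewrite colE mulmxA mulmx_coker mul0mx.
  rewrite row_full_tr tr_row_mx; apply: row_free_col_mx => //.
  by rewrite -row_full_tr.
apply/existsP; rewrite -negb_forall; apply/negP => /forallP sub.
have : ((cokermx B)^T <= M^T)%MS by apply/row_subP => k; rewrite -tr_col.
move/mxrankS; rewrite !mxrank_tr mxrank_coker (eqP fM) leqNgt => /negP; apply.
apply: leq_trans (leq_sub2l m (rank_leq_row B)); rewrite ltn_subRL.
by rewrite addnC addnC.
Qed.

Lemma annihilated_by d (y : 'rV[K]_(1 + d)) :
  exists2 A : 'M_(1 + d, d), y *m A = 0 & row_full A.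
Proof.
exists (invmx (row_ebase y) *m col_mx 0 1%:M).
  rewrite -{1}[y]mulmx_ebase -!mulmxA mulKVmx ?row_ebase_unit //.
  rewrite (_ : pid_mx _ *m col_mx 0 1%:M = 0) ?mulmx0 //.
  apply/rowP => j; rewrite !mxE big_split_ord /= big1 ?add0r => [|k _]; last first.
    by rewrite col_mxEu [X in _ * X]mxE mulr0.
  by apply: big1 => k _; rewrite mxE /= mul0r.
rewrite /row_full eqmxMfull; last by rewrite row_full_unit unitmx_inv row_ebase_unit.
by rewrite -mxrank_tr tr_col_mx trmx0 trmx1 rank_row_0mx mxrank1.
Qed.

(** To treat row [j], add to [M] a column [w] that kills the rows already treated, replace row [j]
    by a good direction [u], and project along its image. The bound [size l + d <= m] leaves room
    for [w], and the rows treated before remain in the kernel. *)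
Lemma inner_projection m d s (X : 'rV[K]_m -> Prop) (S : 'I_s -> 'rV[K]_m -> Prop) g
    (M0 : 'M_(m, d)) (l : seq 'I_s) :
  variety X -> dense X (fun x => x *m M0) ->
  (forall i, variety (S i)) -> (forall i, spanning (S i)) ->
  mxpoly s m g -> meets (fun A => forall i, S i (row i A)) g -> (size l + d <= m)%N ->
  exists A, [/\ forall i, S i (row i A), g A != 0 & exists2 M : 'M_(m, d),
    dense X (fun x => x *m M) & forall i, i \in l -> row i A *m M = 0].
Proof.
move=> vX dM0 vS spS xg [A0 SA0 gA0]; elim: l => [_|j l IH lm].
  by exists A0; split=> //; exists M0.
have [A [SA gA [M dM AM]]] := IH (ltnW lm).
pose B := \matrix_(k < size l) row (tnth (in_tuple l) k) A.
have [w Bw fN] := annihilating_column B (dense_row_full dM) lm.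
have Aw i : i \in l -> row i A *m w = 0.
  move=> il; have lt : (index i l < size l)%N by rewrite index_mem.
  have <- : row (Ordinal lt) B = row i A.
    by rewrite rowK (tnth_nth i) /= nth_index.
  by rewrite -row_mul Bw row0.
have dN : dense X (fun x => x *m rsubmx (row_mx w M)) by rewrite row_mxKr.
have [G [xG SG Gd]] := good_directions vX (vS j) (spS j) fN dN.
have [u Su /=] := (variety_irreducible (vS j)).2 _ _ xG (polyfun_setrow A j xg) SG
  (meets_setrow j SA gA).
rewrite mulf_eq0 => /norP[Gu gu].
have [A2 uA2 fA2] := annihilated_by (u *m row_mx w M).
exists (setrow A j u); split=> // [i|].
  by rewrite row_setrow; case: eqP => [->|].
exists (row_mx w M *m A2); first exact: (Gd u).
move=> i; rewrite row_setrow mulmxA; case: eqP => // ij.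
by rewrite inE => /predU1P[//|il]; rewrite mul_mx_row Aw // AM // row_mx0 mul0mx.
Qed.
End Projection.

(** * Generic properties of spans: from tuples in [X] to arbitrary tuples and back *)

Section Transfer.
Variable K : closedFieldType.
Notation mxpoly s m := (polyfun (@mxcoord K s m)).
Notation mxgen s m := (generically (@mxcoord K s m)).

Definition rows_in s m (X : 'rV[K]_m -> Prop) (A : 'M[K]_(s, m)) := forall i, X (row i A).

Definition span_invariant s m (P : 'M[K]_(s, m) -> Prop) :=
  forall C A, C \in unitmx -> P A -> P (C *m A).

Lemma generically_eqset I T (x : I -> T -> K) (Z Z' P : T -> Prop) :
  (forall z, Z z <-> Z' z) -> generically x Z P -> generically x Z' P.
Proof.
move=> ZZ [g [xg [z Zz gz] gP]]; exists g; split=> //; first by exists z => //; apply/ZZ.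
by move=> y /ZZ; apply: gP.
Qed.

Lemma row'_setrow s m (A : 'M[K]_(s, m)) j u : row' j (setrow A j u) = row' j A.
Proof. by apply/matrixP => i k; rewrite !mxE eq_sym (negPf (neq_lift j i)). Qed.

Lemma setrow_mulmx s m (A : 'M[K]_(s.+1, m)) j x D :
  setrow A j (x + D *m row' j A) =
  setrow 1%:M j (delta_mx 0 j + D *m row' j 1%:M) *m setrow A j x.
Proof.
apply/row_matrixP => i; rewrite row_mul !row_setrow; case: eqP => [_|/eqP ij].
  rewrite mulmxDl -rowE row_setrow eqxx -mulmxA; congr (_ + _ *m _).
  rewrite -[in LHS](row'_setrow A j x); move: (setrow _ _ _) => B.
  by apply/row_matrixP => k; rewrite row_mul !row'Esub !row_rowsub row1 -rowE.
by rewrite row1 -rowE row_setrow (negPf ij).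
Qed.

Lemma setrow_unit s (j : 'I_s.+1) (D : 'rV[K]_s) :
  setrow 1%:M j (delta_mx 0 j + D *m row' j 1%:M) \in unitmx.
Proof.
have E : setrow 1%:M j (delta_mx 0 j - D *m row' j 1%:M) *m
         setrow 1%:M j (delta_mx 0 j + D *m row' j 1%:M) = 1%:M.
  by rewrite -mulNmx -setrow_mulmx mulNmx addrK -row1 setrow_row.
by have [] := mulmx1_unit E.
Qed.

(* The rows are moved from [X] to the whole space one at a time: modulo the span
   of the other rows, general points of [X] fill the whole space. *)
Lemma generically_transfer c d m (X : 'rV[K]_m -> Prop) (M0 : 'M_(m, d)) P :
  (c + d = m)%N -> (0 < d)%N -> variety X -> spanning X ->
  dense X (fun x => x *m M0) ->
  definable (@mxcoord K c.+1 m) P -> span_invariant P ->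
  mxgen c.+1 m (rows_in X) P -> mxgen c.+1 m (fun=> True) P.
Proof.
move=> cd d0 vX spX dM0 dP invP gP.
pose S j (i : 'I_c.+1) : 'rV[K]_m -> Prop := if (i < j)%N then fun=> True else X.
have vS j i : variety (S j i) by rewrite /S; case: ifP => // _; apply: variety_setT.
have spS j i : spanning (S j i) by rewrite /S; case: ifP => // _; apply: spanning_setT.
have SX j i x : X x -> S j i x by rewrite /S; case: ifP.
have irrS j := irreducible_rows (fun i => variety_irreducible (vS j i)).
suff H j : (j <= c.+1)%N -> mxgen c.+1 m (fun A => forall i, S j i (row i A)) P.
  apply: generically_eqset (H c.+1 (leqnn _)) => A; split=> // _ i.
  by rewrite /S ltn_ord.
elim: j => [_|j IH jc]; first exact: gP.
have [g1 [xg1 S1 g1P]] := IH (ltnW jc); pose j0 := Ordinal jc.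
case: (definable_dichotomy (irrS j.+1) dP) => // -[g2 [xg2 [A2 S2 g2A] g2P]].
pose w0 := row j0 A2.
have Sj i x : i != j0 -> S j i x <-> S j.+1 i x.
  by rewrite /S ltnS [(i <= j)%N]leq_eqVlt -val_eqE /= => /negPf->.
have Sj0 x : S j j0 x = X x by rewrite /S ltnn.
have Sj1 x : S j.+1 j0 x by rewrite /S /= ltnSn.
have [B uB XB] := spanning_basis spX.
have cm : (c < m)%N by rewrite -cd -addn1 leq_add2l.
pose f (i : 'I_c) := widen_ord cm (lift j0 i).
have finj : injective f by move=> i k fik; apply: (@lift_inj _ j0); apply: val_inj; apply: (congr1 val fik).
(* [N] is dual to [c] vectors of the basis [B], so the determinant in [G] is not identically zero;
   where it is nonzero, the rows of [A] other than [j0] are independent. *)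
pose N := invmx B *m (rowsub f 1%:M)^T.
have EN : row' j0 (rowsub (widen_ord cm) B) *m N = 1%:M.
  rewrite (_ : row' j0 _ = rowsub f B); last by apply/matrixP => i k; rewrite !mxE.
  rewrite /N -[B in rowsub f B]mul1mx -mul_rowsub_mx mulmxA -[_ *m B *m _]mulmxA mulmxV // mulmx1.
  apply/matrixP => i k; rewrite !mxE (bigD1 (f i)) //= big1 ?addr0 => [|l li].
    by rewrite !mxE eqxx mul1r eq_sym (inj_eq finj) eq_sym.
  by rewrite !mxE eq_sym (negPf li) mul0r.
pose G A := g1 A * (g2 (setrow A j0 w0) * \det (row' j0 A *m N)).
have xs : mxpoly c.+1 m (fun A => g2 (setrow A j0 w0)).
  apply: polyfun_mxcomp xg2; apply: polymap_setrow; first exact: polymap_id.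
  exact: polymap_const.
have xd : mxpoly c.+1 m (fun A => \det (row' j0 A *m N)).
  apply: polyfun_det; apply: polymapM; last exact: polymap_const.
  move=> i k.
  by apply: polyfun_ext (polyfun_coord (@mxcoord K c.+1 m) (lift j0 i, k)) => A; rewrite mxE.
have [A [SA GA [M dM AM]]] : exists A, [/\ forall i, S j i (row i A), G A != 0 &
    exists2 M : 'M_(m, d), dense X (fun x => x *m M) &
    forall i, i \in [seq lift j0 i | i <- enum 'I_c] -> row i A *m M = 0].
  apply: (inner_projection vX dM0 (vS j) (spS j)).
  - by apply: polyfunM => //; apply: polyfunM.
  - apply: (irrS j).2 => //; first exact: polyfunM.
    apply: (irrS j).2 => //.
      have [x Xx] := (variety_irreducible vX).1.
      exists (setrow A2 j0 x); last by rewrite setrowK setrow_row.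
      move=> i; rewrite row_setrow; case: eqP => [->|/eqP ij]; first by rewrite Sj0.
      by apply/Sj.
    exists (rowsub (widen_ord cm) B); last by rewrite EN det1 oner_eq0.
    by move=> i; apply: SX; rewrite row_rowsub.
  by rewrite size_map size_enum_ord cd.
move: GA; rewrite !mulf_eq0 !negb_or => /and3P[g1A g2A' dA].
have {}AM : row' j0 A *m M = 0.
  apply/row_matrixP => i; rewrite row_mul row0 row'Esub row_rowsub AM //.
  by apply/mapP; exists i; rewrite ?mem_enum.
have h1A := meets_setrow j0 SA g1A.
have [g3 [xg3 [t0 _ g3t] g3P]] := dense_lift vX (polymap_mulmxr M) dM
  (polyfun_setrow A j0 xg1) (let: ex_intro2 x Xx fx := h1A in
    ex_intro2 _ _ x (eq_ind _ id Xx _ (Sj0 x)) fx).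
have fM := dense_row_full dM.
(* For a general vector [w] there is [x] in [X] with the same image under [M]; replacing [x] by [w]
   as row [j0] will not change the span. *)
have [w _ /=] := (irreducible_setT K 1 m).2 _ _ (polyfun_mxcomp (polymap_mulmxr M) xg3)
  (polyfun_setrow A j0 xg2) (ex_intro2 _ _ (t0 *m pinvmx M) I
    (eq_ind_r (fun t => g3 t != 0) g3t (mulmxKpV (submx_full t0 fM))))
  (ex_intro2 _ _ w0 I g2A').
rewrite mulf_eq0 => /norP[g3w g2w].
have [x Xx [g1x xw]] := g3P _ I g3w.
have Px : P (setrow A j0 x).
  apply: g1P g1x => i; rewrite row_setrow; case: eqP => [->|_]; last exact: SA.
  by rewrite Sj0.
suff [D Dw] : exists D, w - x = D *m row' j0 A.
  exfalso; apply: g2P g2w _.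
    move=> i; rewrite row_setrow; case: eqP => [->|/eqP ij]; first exact: Sj1.
    by apply/Sj.
  have -> : w = x + D *m row' j0 A by rewrite -Dw addrC subrK.
  by rewrite setrow_mulmx; apply: invP => //; apply: setrow_unit.
(* The kernel of [M] has dimension [m - d = c] and contains the [c] independent rows of [row' j0 A],
   so it is their span. *)
apply/submxP; have wk : (w - x <= kermx M)%MS.
  by apply/sub_kermxP; rewrite mulmxBl xw subrr.
apply: submx_trans wk _.
have kA : (row' j0 A <= kermx M)%MS by apply/sub_kermxP.
have rA : \rank (row' j0 A) = c.
  apply/eqP; rewrite eqn_leq rank_leq_row /=.
  have u : row' j0 A *m N \in unitmx by rewrite unitmxE unitfE.
  by have := mxrankM_maxl (row' j0 A) N; rewrite (mxrank_unit u).
by rewrite -(mxrank_leqif_sup kA) rA mxrank_ker (eqP fM) -cd addnK.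
Qed.

Lemma generically_transfer_back c d m (X : 'rV[K]_m -> Prop) (M0 : 'M_(m, d)) P :
  (c + d = m)%N -> (0 < d)%N -> variety X -> spanning X ->
  dense X (fun x => x *m M0) ->
  definable (@mxcoord K c.+1 m) P -> span_invariant P ->
  mxgen c.+1 m (fun=> True) P -> mxgen c.+1 m (rows_in X) P.
Proof.
move=> cd d0 vX spX dM0 dP invP gP.
have irrX : irreducible_set (@mxcoord K c.+1 m) (rows_in X).
  exact: (irreducible_rows (S := fun=> X) (fun _ => variety_irreducible vX)).
have inv' : span_invariant (fun A => ~ P A).
  move=> C A uC nP PCA; apply: nP; rewrite -[A](mulKmx uC).
  by apply: invP; rewrite ?unitmx_inv.
case: (definable_dichotomy irrX dP) => // nP; exfalso.
have nP' := generically_transfer cd d0 vX spX dM0 (definable_not dP) inv' nP.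
by have [A _ []] := generically_ex (generically_and (irreducible_setT K _ _) gP nP').
Qed.
End Transfer.

(** * Linear spans of general points *)

Section GeneralPoints.
Variable K : closedFieldType.
Notation mxpoly s m := (polyfun (@mxcoord K s m)).
Notation mxgen s m := (generically (@mxcoord K s m)).

Lemma definable_forall_mx (I : finType) T (x : I -> T -> K) s m
    (P : T -> 'M[K]_(s, m) -> Prop) :
  definable (@extcoord K I T x s m) (fun zB => P zB.1 zB.2) ->
  definable x (fun z => forall B, P z B).
Proof.
move=> dP; have := definable_not (definable_ex (P := fun z B => ~ P z B) (definable_not dP)).
apply: definable_ext => z; split=> [nP B|PB [B]]; last by apply.
by apply: NNPP => nB; apply: nP; exists B.
Qed.

Definition has_frame s m (Yo : 'rV[K]_m -> Prop) (A : 'M[K]_(s, m)) :=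
  exists B : 'M_s, B \in unitmx /\ rows_in Yo (B *m A).

Lemma polymap_ext_mulmx I T (x : I -> T -> K) a s m (f : T -> 'M[K]_(s, m)) :
  polymap x f -> polymap (@extcoord K I T x a s) (fun z => z.2 *m f z.1).
Proof.
by move=> xf; apply: polymapM; [apply: polymap_ext_snd | apply: polymap_ext_fst].
Qed.

Lemma definable_has_frame s m Yo : definable (@mxcoord K 1 m) Yo ->
  definable (@mxcoord K s m) (has_frame Yo).
Proof.
move=> dYo; apply: definable_ex; apply: definable_and.
  have := definable_neq0 (polyfun_det (@polymap_ext_snd _ _ _ (@mxcoord K s m) s s)).
  by apply: definable_ext => z; rewrite unitmxE unitfE.
apply: definable_forall => i; apply: (definable_mxsub _ dYo); apply: polymap_row.
exact: (polymap_ext_mulmx (f := id) (@polymap_id K s m)).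
Qed.

Lemma has_frame_invariant s m Yo : span_invariant (@has_frame s m Yo).
Proof.
move=> C A uC [B [uB YB]]; exists (B *m invmx C); split.
  by rewrite unitmx_mul uB unitmx_inv.
by rewrite mulmxA mulmxKV.
Qed.

Lemma generically_has_frame c d m (Y Yo : 'rV[K]_m -> Prop) (M0 : 'M_(m, d)) :
  (c + d = m)%N -> (0 < d)%N -> variety Y -> spanning Y ->
  dense Y (fun x => x *m M0) -> definable (@mxcoord K 1 m) Yo ->
  generically (@mxcoord K 1 m) Y Yo -> mxgen c.+1 m (fun=> True) (has_frame Yo).
Proof.
move=> cd d0 vY spY dM0 dYo gYo.
apply: (generically_transfer cd d0 vY spY dM0 (definable_has_frame _ dYo)).
  exact: has_frame_invariant.
have irrY := irreducible_rows (S := fun _ : 'I_c.+1 => Y) (fun _ => variety_irreducible vY).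
case: gYo => h [xh [y Yy hy] hYo].
have gi i : mxgen c.+1 m (rows_in Y) (fun A => h (row i A) != 0).
  exists (fun A => h (row i A)); split=> //.
    by apply: polyfun_mxcomp xh; apply: polymap_row; apply: polymap_id.
  by exists (\matrix_i y) => [j|]; rewrite rowK.
apply: (generically_imp (generically_forall irrY gi)) => A YA hA.
by exists 1%:M; rewrite unitmx1 mul1mx; split=> // i; apply: hYo.
Qed.

Definition quad m (Q : 'M[K]_m) (v : 'rV_m) := (v *m Q *m v^T) 0 0.

Lemma polyfun_quad I T (x : I -> T -> K) m (Q f : T -> _) :
  polymap x Q -> polymap x f -> polyfun x (fun t => @quad m (Q t) (f t)).
Proof.
move=> xQ xf; rewrite /quad.
have xt : polymap x (fun t => (f t)^T).
  by move=> i j; apply: polyfun_ext (xf j i) => t; rewrite mxE.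
exact: (polymapM (polymapM xf xQ) xt 0 0).
Qed.

Lemma quadDZ m (Q : 'M[K]_m) a v u :
  quad Q (a *: v + u) = a ^+ 2 * quad Q v + a * (u *m ((Q + Q^T) *m v^T)) 0 0 + quad Q u.
Proof.
have tr : v *m Q *m u^T = u *m Q^T *m v^T.
  have -> : u *m Q^T *m v^T = (v *m Q *m u^T)^T by rewrite !trmx_mul !trmxK mulmxA.
  by apply/matrixP => i j; rewrite !ord1 [RHS]mxE.
rewrite /quad [(_ + _)^T]linearD /= [(_ *: _)^T]linearZ /= mulmxA.
rewrite 2!mulmxDl 2![_ *m (_ + _)]mulmxDr [u *m (_ + _)]mulmxDr [(_ + _) *m v^T]mulmxDl.
rewrite -!scalemxAl -!scalemxAr tr.
move: (v *m Q *m v^T) (u *m Q *m v^T) (u *m Q^T *m v^T) (u *m Q *m u^T) => s1 s2 s3 s4.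
by rewrite !mxE; ring.
Qed.

Definition avoids_first_coordinate c m (Xo : 'rV[K]_m -> Prop) (A : 'M[K]_(c.+1, m)) :=
  exists B : 'M_c.+1, [/\ B \in unitmx, rows_in Xo (B *m A) & forall i, B i 0 != 0].

Lemma definable_avoids c m Xo : definable (@mxcoord K 1 m) Xo ->
  definable (@mxcoord K c.+1 m) (avoids_first_coordinate Xo).
Proof.
move=> dXo.
suff H : definable (@mxcoord K c.+1 m) (fun A => exists B : 'M_c.+1,
    B \in unitmx /\ (rows_in Xo (B *m A) /\ forall i, B i 0 != 0)).
  apply: definable_ext H => A.
  by split=> -[B]; [case=> ? [? ?]|case=> ? ? ?]; exists B.
apply: definable_ex; apply: definable_and.
  have := definable_neq0 (polyfun_det (@polymap_ext_snd _ _ _ (@mxcoord K c.+1 m) c.+1 c.+1)).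
  by apply: definable_ext => z; rewrite unitmxE unitfE.
apply: definable_and; apply: definable_forall => i.
  apply: (definable_mxsub _ dXo); apply: polymap_row.
  exact: (polymap_ext_mulmx (f := id) (@polymap_id K c.+1 m)).
by apply: definable_neq0; apply: polymap_ext_snd.
Qed.

(* A shear of the frame moves the hyperplane spanned by the last rows off the
   given points. *)
Lemma generically_avoids c m (Xo : 'rV[K]_m -> Prop) : definable (@mxcoord K 1 m) Xo ->
  mxgen c.+1 m (fun=> True) (has_frame Xo) ->
  mxgen c.+1 m (fun=> True) (avoids_first_coordinate Xo).
Proof.
move=> dXo gF; have irrT := irreducible_setT K.
case: (definable_dichotomy (irrT c.+1 m) (definable_avoids c dXo)) => // -[g [xg Tg gP]].
exfalso; have [A _ [gA [B [uB XB]]]] :=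
  generically_ex (generically_and (irrT c.+1 m) (generically_neq0 xg Tg) gF).
pose e0 : 'rV[K]_c.+1 := delta_mx 0 0.
(* [T t] adds multiples of the first row to the others and keeps the first; [T' t] is its
   inverse. *)
pose T (t : 'cV[K]_c) : 'M[K]_c.+1 := 1%:M + col_mx (0 : 'M_1) t *m e0.
pose T' (t : 'cV[K]_c) : 'M[K]_c.+1 := 1%:M - col_mx (0 : 'M_1) t *m e0.
have e0t t : e0 *m col_mx (0 : 'M_1) t = 0.
  by apply/rowP => j; rewrite -rowE !mxE; case: split_ordP => // k _; rewrite mxE.
have TT t : T' t *m T t = 1%:M.
  rewrite /T' /T; set N := col_mx _ _ *m e0.
  have NN : N *m N = 0 by rewrite -mulmxA [e0 *m _]mulmxA e0t mul0mx mulmx0.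
  by rewrite mulmxDr mulmx1 mulmxBl mul1mx NN subr0 subrK.
have xT : polymap (@mxcoord K c 1) T.
  apply: polymapD; first exact: polymap_const.
  apply: polymapM; last exact: polymap_const.
  move=> i j; case: (split_ordP (i : 'I_(1 + c))) => k ->.
    by apply: polyfun_ext (polyfun_const _ 0) => t; rewrite (col_mxEu (0 : 'M_1) t) mxE.
  by apply: polyfun_ext (polyfun_coord (@mxcoord K c 1) (k, j)) => t; rewrite (col_mxEd (0 : 'M_1) t).
have xT' : polymap (@mxcoord K c 1) T'.
  have E t : T' t = 1%:M + (1%:M - T t).
    by rewrite /T' /T opprD [1%:M + (- _ - _)]addNKr.
  move=> i j; apply: (@polyfun_ext _ _ _ _ (fun t => (1%:M : 'M_c.+1) i j + ((1%:M : 'M_c.+1) i j - T t i j))).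
    by move=> t; rewrite E !mxE.
  by apply: polyfunD; [apply: polyfun_const | apply: polyfunB; [apply: polyfun_const | apply: xT]].
have gT : mxgen c 1 (fun=> True) (fun t => g (T t *m A) != 0).
  exists (fun t => g (T t *m A)); split=> //.
    by apply: polyfun_mxcomp xg; apply: polymapM => //; apply: polymap_const.
  exists 0 => //; rewrite (_ : T 0 = 1%:M) ?mul1mx //.
  by rewrite /T (_ : col_mx 0 0 = 0) ?mul0mx ?addr0 //; apply: col_mx0.
have gB i : mxgen c 1 (fun=> True) (fun t => (B *m T' t) i 0 != 0).
  exists (fun t => (B *m T' t) i 0); split=> //.
    by apply: polymapM => //; apply: polymap_const.
  have EB t : (B *m T' t) i 0 = B i 0 - \sum_j B i (rshift 1 j) * t j 0.
    rewrite mulmxBr mulmx1 mulmxA !mxE; congr (_ - _).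
    rewrite big_ord1 !mxE !eqxx mulr1 big_ord_recl.
    have z0 : (col_mx (0 : 'M_1) t : 'cV_c.+1) ord0 0 = 0.
      by rewrite mxE; case: splitP => // k _; rewrite mxE.
    rewrite z0 mulr0 add0r.
    apply: eq_bigr => j _; rewrite (_ : lift ord0 j = rshift 1 j); last exact: val_inj.
    by rewrite (col_mxEd (0 : 'M_1) t).
  have [Bi0|Bi0] := eqVneq (B i 0) 0; last first.
    by exists 0 => //; rewrite EB big1 ?subr0 // => j _; rewrite mxE mulr0.
  have [j Bij] : exists j : 'I_c, B i (rshift 1 j) != 0.
    apply/existsP; rewrite -negb_forall; apply/negP => /forallP B0.
    have : row i B = 0.
      apply/rowP => j; rewrite !mxE; case: (split_ordP (j : 'I_(1 + c))) => k ->.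
        by rewrite ord1 -[RHS]Bi0; congr (B i _); apply: val_inj.
      by apply/eqP; apply: B0.
    move=> Bi; have := congr1 (row i) (mulmxV uB); rewrite row_mul Bi mul0mx row1.
    by move/rowP/(_ i); rewrite !mxE !eqxx => /esym/eqP; rewrite oner_eq0.
  exists (delta_mx j 0) => //; rewrite EB Bi0 sub0r (bigD1 j) //= big1.
    by rewrite addr0 mxE !eqxx mulr1 oppr_eq0.
  by move=> k kj; rewrite mxE (negPf kj) mulr0.
have [t _ [gt Bt]] := generically_ex (generically_and (irrT c 1) gT
  (generically_forall (irrT c 1) gB)).
apply: (gP _ _ gt) => //; exists (B *m T' t); split=> //; last first.
  by rewrite mulmxA -[B *m _ *m _]mulmxA TT mulmx1.
by rewrite unitmx_mul uB; have [->] := mulmx1_unit (TT t).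
Qed.

(** For general [w], the span of [w] and the last [c] rows has a basis of points of [X] off the
    hyperplane of these rows. A quadric containing that hyperplane is, on this span, the
    [w]-coordinate times a linear form; if it contains [X], the form vanishes on the basis, so the
    quadric vanishes at [w]. *)
Lemma quadric_through_hyperplane c d m (X : 'rV[K]_m -> Prop) (M0 : 'M_(m, d)) g :
  (c + d = m)%N -> (0 < d)%N -> variety X -> spanning X ->
  dense X (fun x => x *m M0) -> mxpoly c.+1 m g -> meets (fun=> True) g ->
  exists2 A, g A != 0 & forall Q, (forall x, X x -> quad Q x = 0) ->
    (forall u, quad Q (u *m row' 0 A) = 0) -> forall w, quad Q w = 0.
Proof.
move=> cd d0 vX spX dM0 xg Tg; case: (variety_model vX) => Xo [dXo XoX gXo].
have irrT := irreducible_setT K.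
have [g2 [xg2 Tg2 g2P]] := generically_avoids dXo
  (generically_has_frame cd d0 vX spX dM0 dXo gXo).
have [A _ /=] := (irrT _ _).2 _ _ xg xg2 Tg Tg2.
rewrite mulf_eq0 => /norP[gA g2A]; exists A => // Q XQ QA w.
have xs := polyfun_setrow A 0 xg2.
have xQ : mxpoly 1 m (quad Q).
  by apply: polyfun_quad; [apply: polymap_const | apply: polymap_id].
apply: (vanishesM (irrT 1 m) xs xQ _ _ (z := w)) => //.
  by exists (row 0 A); rewrite ?setrow_row.
move=> {}w _ /=; apply/eqP; rewrite mulf_eq0; apply/orP.
have [g2w|g2w] := eqVneq (g2 (setrow A 0 w)) 0; [by left | right].
have [B [uB XB B0]] := g2P _ I g2w.
(* [y] lists the coefficients of the second linear factor of [Q] in the basis formed by [w] and the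
   last rows. *)
pose y := col_mx (quad Q w)%:M (row' 0 A *m ((Q + Q^T) *m w^T)).
suff y0 : B *m (y : 'cV_c.+1) = 0.
  have : (y : 'cV_c.+1) = 0 by rewrite -[y](mulKmx uB) y0 mulmx0.
  move/(congr1 (fun z : 'cV[K]_(1 + c) => z (lshift c 0) 0)).
  by rewrite col_mxEu !mxE eqxx mulr1n => ->.
apply/colP => i; rewrite [RHS]mxE.
have E : row i (B *m setrow A 0 w) = B i 0 *: w + row i (col' 0 B) *m row' 0 A.
  apply/rowP => k; rewrite !mxE big_ord_recl mxE eqxx; congr (_ + _).
  by apply: eq_bigr => j _; rewrite !mxE.
have := XQ _ (XoX _ (XB i)); rewrite E quadDZ QA addr0 expr2 -mulrA -mulrDr => /eqP.
rewrite mulf_eq0 (negPf (B0 i)) /= => /eqP <-.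
have yE0 : (y : 'cV_c.+1) ord0 0 = quad Q w.
  by rewrite /y mxE; case: splitP => // k _; rewrite !ord1 mxE eqxx mulr1n.
have yES j : (y : 'cV_c.+1) (lift ord0 j) 0 = (row' 0 A *m ((Q + Q^T) *m w^T)) j 0.
  have -> : lift ord0 j = rshift 1 j by apply: val_inj.
  exact: col_mxEd.
rewrite mxE big_ord_recl yE0; congr (_ + _).
by rewrite -mulmxA mxE; apply: eq_bigr => j _; rewrite yES !mxE.
Qed.

Definition quads_injective s m b (q : 'I_b -> 'M[K]_m) (A : 'M[K]_(s, m)) :=
  forall a : 'rV_b, (forall u : 'rV_s, quad (\sum_l a 0 l *: q l) (u *m A) = 0) -> a = 0.

Lemma definable_quads_injective s m b (q : 'I_b -> 'M[K]_m) :
  definable (@mxcoord K s m) (quads_injective q).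
Proof.
apply: definable_forall_mx; apply: definable_imp; last first.
  by apply: definable_eqmx; [apply: polymap_ext_snd | apply: polymap_const].
apply: definable_forall_mx; apply: definable_eq0; apply: polyfun_quad.
  move=> i j.
  apply: (@polyfun_ext _ _ _ _ (fun z : 'M[K]_(s, m) * 'rV[K]_b * 'rV[K]_s => \sum_l z.1.2 0 l * q l i j)).
    by move=> z; rewrite summxE; apply: eq_bigr => l _; rewrite mxE.
  apply: polyfun_sum => l; apply: polyfunM; last exact: polyfun_const.
  by apply: (@polyfun_ext_fst _ _ _ _ _ _ (fun z : 'M[K]_(s, m) * 'rV[K]_b => z.2 0 l)); apply: polymap_ext_snd.
apply: (polymap_ext_mulmx (f := fst)).
exact: (@polymap_ext_fst _ _ _ _ _ _ _ _ id (@polymap_id K s m)).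
Qed.

Lemma quads_injective_invariant s m b (q : 'I_b -> 'M[K]_m) :
  span_invariant (@quads_injective s m b q).
Proof.
move=> C A uC inj a a0; apply: inj => u.
by have := a0 (u *m invmx C); rewrite mulmxA mulmxKV.
Qed.

(** Injectivity depends only on the span, so it is enough to prove it for arbitrary tuples; there,
    already the restriction to the span of the last [c] rows determines a quadric through [X]. *)
Lemma generically_quads_injective c d m b (X : 'rV[K]_m -> Prop) (M0 : 'M_(m, d))
    (q : 'I_b -> 'M[K]_m) :
  (c + d = m)%N -> (0 < d)%N -> variety X -> spanning X ->
  dense X (fun x => x *m M0) -> (forall l x, X x -> quad (q l) x = 0) ->
  (forall a : 'rV_b, (forall w, quad (\sum_l a 0 l *: q l) w = 0) -> a = 0) ->
  mxgen c.+1 m (rows_in X) (quads_injective q).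
Proof.
move=> cd d0 vX spX dM0 Xq inj.
have dq := definable_quads_injective c.+1 q.
apply: (generically_transfer_back cd d0 vX spX dM0 dq (@quads_injective_invariant _ _ _ q)).
case: (definable_dichotomy (irreducible_setT K _ _) dq) => // -[g [xg Tg gP]]; exfalso.
have [A gA AQ] := quadric_through_hyperplane cd d0 vX spX dM0 xg Tg.
apply: (gP A I gA) => a a0; apply: inj; apply: AQ => [x Xx|u].
  rewrite /quad mulmx_sumr mulmx_suml summxE big1 // => l _.
  by rewrite -scalemxAr -scalemxAl mxE -/(quad (q l) x) Xq // mulr0.
have -> : row' 0 A = row' 0 1%:M *m A.
  by apply/row_matrixP => i; rewrite row_mul !row'Esub !row_rowsub row1 -rowE.
by rewrite mulmxA.
Qed.

Definition in_open_span s m (Yo : 'rV[K]_m -> Prop) (A : 'M[K]_(s, m)) :=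
  exists b : 'rV_s, (forall j, b 0 j != 0) /\ Yo (b *m A).

Lemma definable_in_open_span s m Yo : definable (@mxcoord K 1 m) Yo ->
  definable (@mxcoord K s m) (in_open_span Yo).
Proof.
move=> dYo; apply: definable_ex; apply: definable_and.
  apply: definable_forall => j; apply: definable_neq0; exact: polymap_ext_snd.
apply: (definable_mxsub _ dYo).
exact: (polymap_ext_mulmx (f := id) (@polymap_id K s m)).
Qed.
End GeneralPoints.

(** * Quadrics through the coordinate points, indexed by pairs *)

Definition lt_pairs s : {set 'I_s * 'I_s} := [set p : 'I_s * 'I_s | p.1 < p.2]%N.

Lemma card_lt_pairs s : #|lt_pairs s| = 'C(s, 2).
Proof.
rewrite -sum1_card -bin2_sum big_mkord.
under eq_bigl do rewrite inE.
rewrite -(pair_big_dep xpredT (fun i j : 'I_s => (i < j)%N) (fun _ _ => 1%N)) /=.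
rewrite (exchange_big_dep xpredT) //=; apply: eq_bigr => j _.
by rewrite (big_ord_narrow (ltnW (ltn_ord j))) sum1_card card_ord.
Qed.

Section PairProducts.
Variable K : closedFieldType.
Implicit Types s t b m : nat.

(** Row [r] holds the values at the point [row r E] of the monomials [x_i x_j] with [i < j], a basis
    of the quadrics through the coordinate points. The rank is the number of conditions imposed by
    the rows of [E] on these quadrics. *)
Definition pairmx t s (E : 'M[K]_(t, s)) : 'M[K]_(t, #|lt_pairs s|) :=
  \matrix_(r, k) (E r (enum_val k).1 * E r (enum_val k).2).

Lemma pairmx_col s (i j : 'I_s) : i != j ->
  exists k, forall t (E : 'M[K]_(t, s)) r, pairmx E r k = E r i * E r j.
Proof.
wlog lt : i j / (i < j)%N => [H|] ij.
  case: (ltngtP i j) => [lt|lt|/val_inj E]; first exact: H.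
    rewrite eq_sym in ij; have [k Ek] := H j i lt ij.
    by exists k => t E r; rewrite Ek mulrC.
  by rewrite E eqxx in ij.
have ijP : (i, j) \in lt_pairs s by rewrite inE.
by exists (enum_rank_in ijP (i, j)) => t E r; rewrite mxE enum_rankK_in.
Qed.

Lemma sum_lt_pairs s (F : 'I_s * 'I_s -> K) : (forall i, F (i, i) = 0) ->
  \sum_p F p = \sum_(p in lt_pairs s) (F p + F (p.2, p.1)).
Proof.
move=> F0; rewrite big_split /= (bigID (mem (lt_pairs s))) /=; congr (_ + _).
rewrite (bigID (fun p : 'I_s * 'I_s => p.1 == p.2)) /= big1 ?add0r; last first.
  by move=> [i j] /andP[_ /eqP /= ->].
rewrite (reindex (fun p : 'I_s * 'I_s => (p.2, p.1))) /=; last first.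
  by exists (fun p : 'I_s * 'I_s => (p.2, p.1)) => -[].
apply: eq_bigl => -[i j]; rewrite !inE /= -leqNgt leq_eqVlt eq_sym.
by rewrite -val_eqE /=; case: ltngtP.
Qed.

Lemma quad_zero_diagonal s (S : 'M[K]_s) (u : 'rV_s) : (forall i, S i i = 0) ->
  quad S u = \sum_(k < #|lt_pairs s|) (S (enum_val k).1 (enum_val k).2 +
     S (enum_val k).2 (enum_val k).1) * pairmx u 0 k.
Proof.
move=> S0; pose F (p : 'I_s * 'I_s) := S p.1 p.2 * (u 0 p.1 * u 0 p.2).
have -> : quad S u = \sum_p F p.
  rewrite -(pair_big xpredT xpredT (fun i j => F (i, j))) /= exchange_big /=.
  rewrite /quad mxE; apply: eq_bigr => j _; rewrite !mxE mulr_suml.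
  by apply: eq_bigr => i _; rewrite /F /=; ring.
rewrite sum_lt_pairs => [|i]; last by rewrite /F S0 mul0r.
rewrite big_enum_val; apply: eq_bigr => k _; rewrite /F mxE /=; ring.
Qed.

Lemma quad_mulmx s m (Q : 'M[K]_m) (u : 'rV_s) (A : 'M_(s, m)) :
  quad Q (u *m A) = quad (A *m Q *m A^T) u.
Proof. by rewrite /quad trmx_mul !mulmxA. Qed.

Lemma quad_sum m b (q : 'I_b -> 'M[K]_m) (a : 'rV_b) v :
  quad (\sum_l a 0 l *: q l) v = \sum_l a 0 l * quad (q l) v.
Proof.
rewrite /quad mulmx_sumr mulmx_suml summxE; apply: eq_bigr => l _.
by rewrite -scalemxAr -scalemxAl mxE.
Qed.

Lemma row_free_from_kernel s m (A : 'M[K]_(s, m)) :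
  (forall a : 'rV_s, a *m A = 0 -> a = 0) -> row_free A.
Proof.
move=> inj; rewrite -kermx_eq0; apply/eqP/row_matrixP => i; rewrite row0.
by apply: inj; rewrite -row_mul mulmx_ker row0.
Qed.

(** Vanishing at the rows of [A] leaves only mixed coefficients, collected in [Phi]. Injectivity
    makes [Phi] row free, and the points of [E] make it orthogonal to [pairmx E]. *)
Lemma quads_bound s m b t (A : 'M[K]_(s, m)) (q : 'I_b -> 'M[K]_m) (E : 'M[K]_(t, s)) :
  quads_injective q A -> (forall l i, quad (q l) (row i A) = 0) ->
  (forall l r, quad (q l) (row r E *m A) = 0) ->
  (b + \rank (pairmx E) <= 'C(s, 2))%N.
Proof.
move=> inj qA qE; pose S l := A *m q l *m A^T.
have S0 l i : S l i i = 0.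
  by rewrite -(qA l i) rowE quad_mulmx -/(S l) /quad -rowE trmx_delta -colE !mxE.
pose Phi : 'M[K]_(b, #|lt_pairs s|) := \matrix_(l, k)
  (S l (enum_val k).1 (enum_val k).2 + S l (enum_val k).2 (enum_val k).1).
have qPhi l u : quad (q l) (u *m A) = (row l Phi *m (pairmx u)^T) 0 0.
  rewrite quad_mulmx -/(S l) quad_zero_diagonal // mxE.
  by apply: eq_bigr => k _; rewrite !mxE.
have fPhi : row_free Phi.
  apply: row_free_from_kernel => a a0; apply: inj => u.
  rewrite quad_sum; under eq_bigr do rewrite qPhi.
  transitivity ((a *m Phi *m (pairmx u)^T) 0 0); last by rewrite a0 mul0mx mxE.
  rewrite (mulmx_sum_row a Phi) mulmx_suml summxE; apply: eq_bigr => l _.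
  by rewrite -scalemxAl [RHS]mxE.
rewrite -card_lt_pairs -{1}(eqP fPhi) -(mxrank_tr (pairmx E)).
apply: mulmx0_rank_max; apply/matrixP => l r; rewrite [RHS]mxE -(qE l r) qPhi !mxE.
by apply: eq_bigr => k _; rewrite !mxE.
Qed.

Lemma pairmx_col_mx t1 t2 s (E1 : 'M[K]_(t1, s)) (E2 : 'M[K]_(t2, s)) :
  pairmx (col_mx E1 E2) = col_mx (pairmx E1) (pairmx E2).
Proof.
apply/matrixP => r k; rewrite mxE; case: (split_ordP r) => i ->.
  by rewrite !col_mxEu mxE.
by rewrite !col_mxEd mxE.
Qed.

Lemma rank_colsub_le a n l (p : 'I_l -> 'I_n) (M : 'M[K]_(a, n)) :
  (\rank (colsub p M) <= \rank M)%N.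
Proof. by rewrite -[M in colsub p M]mulmx1 -mulmx_colsub mxrankM_maxl. Qed.

Lemma rank_diagonal_minor t n (M : 'M[K]_(t, n)) (p : 'I_t -> 'I_n) :
  (forall i j, (M i (p j) != 0) = (i == j)) -> (t <= \rank M)%N.
Proof.
move=> Mp; apply: leq_trans (rank_colsub_le p M).
have -> : colsub p M = diag_mx (\row_i M i (p i)).
  apply/matrixP => i j; rewrite !mxE; have := Mp i j.
  by have [->|_] := eqVneq i j; rewrite ?mulr1n // mulr0n => /eqP.
rewrite mxrank_unit // unitmxE det_diag unitfE; apply/prodf_neq0 => i _.
by rewrite mxE Mp.
Qed.

Lemma rank_col_mx_ge a1 a2 n l (p : 'I_l -> 'I_n) (M1 : 'M[K]_(a1, n)) (M2 : 'M[K]_(a2, n)) :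
  colsub p M2 = 0 -> (\rank (colsub p M1) + \rank M2 <= \rank (col_mx M1 M2))%N.
Proof.
move=> M20; pose B : 'M[K]_(n, l) := colsub p 1%:M.
have EB a (M : 'M_(a, n)) : M *m B = colsub p M by rewrite mulmx_colsub mulmx1.
rewrite -(mxrank_mul_ker (col_mx M1 M2) B); apply: leq_add.
  by rewrite mul_col_mx !EB -addsmxE mxrankS // addsmxSl.
rewrite mxrankS // sub_capmx -addsmxE addsmxSr /=.
by apply/sub_kermxP; rewrite EB.
Qed.
End PairProducts.

(** * Points imposing independent conditions on quadrics *)

Section ManyConditions.
Variable K : closedFieldType.

Definition rvsupp s (u : 'rV[K]_s) : {set 'I_s} := [set i | u 0 i != 0].

(** The monomial of the pair [i r], [j r] is nonzero exactly at the points whose support contains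
    that pair, so these columns form a diagonal minor. *)
Lemma diagonal_points s t (Yu : 'rV[K]_s -> Prop) (T : 'I_t -> {set 'I_s}) (i j : 'I_t -> 'I_s) :
  (forall r, i r != j r) -> (forall a b, (i b \in T a) && (j b \in T a) = (a == b)) ->
  (forall r, exists u, Yu u /\ rvsupp u = T r) ->
  exists E : 'M[K]_(t, s), (forall r, Yu (row r E)) /\ (t <= \rank (pairmx E))%N.
Proof.
move=> ij ijT TY; have [e eP] := fin_all_exists TY.
have [k kP] := fin_all_exists (fun r => pairmx_col K (ij r)).
exists (\matrix_r e r); split=> [r|]; first by rewrite rowK; case: (eP r).
apply: (rank_diagonal_minor (p := k)) => a b.
rewrite kP !mxE mulf_eq0 negb_or -ijT; have [_ <-] := eP a.
by rewrite !inE.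
Qed.

Lemma card_initial c n : (n <= c)%N -> #|[set i : 'I_c | (i < n)%N]| = n.
Proof.
move=> nc; rewrite -sum1_card; under eq_bigl do rewrite inE.
by rewrite (big_ord_narrow nc) sum1_card card_ord.
Qed.

Section Configuration.
Variables (c : nat) (B : 'M[K]_c.+1) (Yu : 'rV[K]_c.+1 -> Prop).
Hypotheses (uB : B \in unitmx) (YB : forall r, Yu (row r B)).

Let covered k := exists t (E : 'M[K]_(t, c.+1)),
  (forall r, Yu (row r E)) /\ (k <= \rank (pairmx E))%N.

Let all_supports s := forall T : {set 'I_c.+1}, #|T| = s -> exists u, Yu u /\ rvsupp u = T.

(* The supports used are [0, s + 1] minus one of the pairs 01, 02, 03, 12; the
   complements of these pairs in 0123 index a diagonal minor. *)
Lemma short_supports s : (2 <= s < c)%N -> all_supports s -> covered 4.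
Proof.
move=> /andP[s2 sc] sY; pose o n : 'I_c.+1 := inord n.
have oE n : (n <= 3)%N -> o n = n :> nat by move=> n3; rewrite inordK //; lia.
pose q (r : 'I_4) := nth 0 [:: 0; 0; 0; 1]%N r; pose q' (r : 'I_4) := nth 0 [:: 1; 2; 3; 2]%N r.
pose i (r : 'I_4) := o (nth 0 [:: 2; 1; 1; 0]%N r).
pose j (r : 'I_4) := o (nth 0 [:: 3; 3; 2; 3]%N r).
pose T r := [set x : 'I_c.+1 | (x < s.+2)%N] :\ o (q r) :\ o (q' r).
exists 4; apply: (diagonal_points (T := T) (i := i) (j := j)).
- by case=> [[|[|[|[|]]]]] // ?; rewrite -val_eqE /= !oE.
- case=> [[|[|[|[|]]]]] // ?; case=> [[|[|[|[|]]]]] // ?;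
    by rewrite !inE -!val_eqE /= !oE //= ?andbT ?andbF //; lia.
move=> r; apply: sY; have := card_initial (sc : (s.+2 <= c.+1)%N).
rewrite (cardsD1 (o (q r))) => E1; have E2 := cardsD1 (o (q' r)) ([set x : 'I_c.+1 | (x < s.+2)%N] :\ o (q r)).
move: E1; rewrite E2 -/(T r) !inE.
have qs : (q' r < s.+2)%N by rewrite /q'; case: r {E2} => [[|[|[|[|]]]]] //= ?; lia.
by case: r qs {E2} => [[|[|[|[|]]]]] // ? qs; rewrite -!val_eqE /= !oE //= ?qs => -[].
Qed.

(** The supports omit 0, 1 or 2, and the diagonal minor is indexed by the pairs 12, 02, 01. *)
Lemma cosingleton_supports : (2 <= c)%N -> all_supports c -> covered 3.
Proof.
move=> c2 cY; pose o n : 'I_c.+1 := inord n.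
have oE n : (n <= 2)%N -> o n = n :> nat by move=> n2; rewrite inordK //; lia.
pose T (r : 'I_3) := ~: [set o r].
pose i (r : 'I_3) := o (nth 0 [:: 1; 0; 0] r)%N.
pose j (r : 'I_3) := o (nth 0 [:: 2; 2; 1] r)%N.
exists 3; apply: (diagonal_points (T := T) (i := i) (j := j)).
- by case=> [[|[|[|]]]] // ?; rewrite -val_eqE /= !oE.
- by case=> [[|[|[|]]]] // ?; case=> [[|[|[|]]]] // ?; rewrite !inE -!val_eqE /= !oE.
by move=> r; apply: cY; rewrite cardsC1 card_ord.
Qed.

Lemma pairmx_first_column : exists p : 'I_c -> 'I_#|lt_pairs c.+1|, forall k t (E : 'M[K]_(t, c.+1)) r,
  pairmx E r (p k) = E r 0 * E r (lift 0 k).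
Proof.
have H (k : 'I_c) : exists l, forall t (E : 'M[K]_(t, c.+1)) r,
    pairmx E r l = E r 0 * E r (lift 0 k) by apply: pairmx_col.
by have [p pE] := fin_all_exists H; exists p.
Qed.

Lemma rank_col' : \rank (col' 0 B) = c.
Proof.
have -> : col' 0 B = B *m col' 0 1%:M by rewrite !col'Esub mulmx_colsub mulmx1.
rewrite eqmxMfull ?row_full_unit //; apply/eqP; rewrite eqn_leq rank_leq_col /=.
have E : (col' 0 1%:M : 'M[K]_(c.+1, c))^T *m col' 0 1%:M = 1%:M.
  apply/matrixP => i j; rewrite mxE (bigD1 (lift 0 i)) //=.
  rewrite big1 ?addr0 => [|k ki]; first by rewrite !mxE eqxx mul1r (inj_eq lift_inj).
  by rewrite !mxE (negPf ki) mul0r.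
by rewrite -{1}[c](mxrank1 K) -E mxrankM_maxr.
Qed.

Let D := diag_mx (\row_r B r 0).

Lemma colsub_pairmx (p : 'I_c -> 'I_#|lt_pairs c.+1|) :
  (forall k t (E : 'M[K]_(t, c.+1)) r, pairmx E r (p k) = E r 0 * E r (lift 0 k)) ->
  colsub p (pairmx B) = D *m col' 0 B.
Proof.
by move=> pE; apply/matrixP => r k; rewrite mxE pE mul_diag_mx !mxE.
Qed.

(** The products with coordinate 0 already suffice: their matrix is [D *m col' 0 B] with [D]
    invertible. *)
Lemma full_supports : (forall r i, B r i != 0) -> covered c.
Proof.
move=> B0; exists c.+1, B; split=> //.
have [p pE] := pairmx_first_column; apply: leq_trans (rank_colsub_le p _).
rewrite (colsub_pairmx pE) eqmxMfull ?rank_col' // row_full_unit unitmxE det_diag unitfE.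
by apply/prodf_neq0 => r _; rewrite mxE.
Qed.

(* The products of coordinate 0 with the others see only the points off that
   face; if these have rank at most two, enough points of the frame lie on it. *)
Lemma near_full_supports : (4 <= c)%N -> all_supports c ->
  (forall r, (c <= #|rvsupp (row r B)|)%N) -> covered 4.
Proof.
move=> c4 cY Bc; have [p pE] := pairmx_first_column.
have [e eP] : exists e : 'I_c.+1 -> 'rV[K]_c.+1, forall i, Yu (e i) /\ rvsupp (e i) = ~: [set i].
  have H i : exists u, Yu u /\ rvsupp u = ~: [set i] by apply: cY; rewrite cardsC1 card_ord.
  by have [e eP] := fin_all_exists H; exists e.
have eE i j : (e i 0 j != 0) = (i != j).
  by have [_ /setP/(_ j)] := eP i; rewrite !inE [j == i]eq_sym.
have eE0 i : e i 0 i = 0 by apply/eqP; have := eE i i; rewrite eqxx /= => /negbFE.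
(* With rank three here, the fourth condition comes from [e 0]: all its products with coordinate 0
   vanish, but its product of coordinates 1 and 2 does not. *)
case: (leqP 3 (\rank (D *m col' 0 B))) => rD.
  exists (c.+1 + 1)%N, (col_mx B (e 0)); split.
    move=> r; case: (split_ordP r) => k ->; rewrite ?rowKu ?rowKd //.
    by rewrite ord1 row_id; case: (eP 0).
  rewrite pairmx_col_mx -[X in (X <= _)%N]/(3 + 1)%N.
  apply: leq_trans (rank_col_mx_ge (p := p) _ _); last first.
    by apply/matrixP => r k; rewrite mxE pE ord1 eE0 mul0r mxE.
  rewrite (colsub_pairmx pE); apply: leq_add => //.
  rewrite lt0n mxrank_eq0.
  have c1 : (1 < c.+1)%N by lia. have c2 : (2 < c.+1)%N by lia.
  have [k kE] := @pairmx_col K c.+1 (Ordinal c1) (Ordinal c2) isT.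
  apply/eqP => /matrixP/(_ 0 k); rewrite kE mxE; apply/eqP.
  by rewrite mulf_neq0 // eE.
(* [Z] keeps the frame points on the face where coordinate 0 vanishes; the convention that the
   inverse of 0 is 0 makes [Di] discard exactly these. As [col' 0 B] has rank [c >= 4] and the part
   off the face at most 2, two independent frame points lie on the face. *)
pose Z := diag_mx (\row_r (B r 0 == 0)%:R : 'rV[K]_c.+1).
pose Di := diag_mx (\row_r (B r 0)^-1 : 'rV[K]_c.+1).
have EB : col' 0 B = Z *m col' 0 B + Di *m (D *m col' 0 B).
  apply/matrixP => r k; rewrite mxE !mul_diag_mx !mxE.
  have [->|B0] := eqVneq (B r 0) 0; first by rewrite mul1r invr0 mul0r addr0.
  by rewrite mul0r add0r mulKf.
have rZ : (2 <= \rank (Z *m col' 0%R B))%N.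
  have le2 : (\rank (Di *m (D *m col' 0%R B)) <= 2)%N by apply: leq_trans (mxrankM_maxr _ _) rD.
  have le : (c <= \rank (Z *m col' 0%R B) + \rank (Di *m (D *m col' 0%R B)))%N.
    by rewrite -[X in (X <= _)%N]rank_col' {1}EB mxrank_add.
  by move: (leq_trans le (leq_add (leqnn _) le2)); move: (\rank _) => n; lia.
have [r0 [r1 [n0 n01]]] : exists r0 r1, row r0 (Z *m col' 0 B) != 0 /\
    ~~ (row r1 (Z *m col' 0 B) <= row r0 (Z *m col' 0 B))%MS.
  have /existsP[r0 n0] : [exists r, row r (Z *m col' 0 B) != 0].
    rewrite -negb_forall; apply: contraL rZ => /forallP H.
    suff -> : Z *m col' 0 B = 0 by rewrite mxrank0.
    by apply/row_matrixP => r; rewrite row0; apply/eqP/H.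
  exists r0; have /existsP[r1 n1] : [exists r, ~~ (row r (Z *m col' 0 B) <= row r0 (Z *m col' 0 B))%MS].
    rewrite -negb_forall; apply: contraL rZ => /forallP H.
    rewrite -ltnNge; apply: leq_ltn_trans (mxrankS _) (rank_leq_row _ : (_ < 2)%N).
    by apply/row_subP.
  by exists r1.
have rowZ r : row r (Z *m col' 0 B) != 0 -> B r 0 = 0.
  move=> nr; apply/eqP; apply: contraNT nr => /negPf B0.
  by apply/eqP/rowP => k; rewrite mxE mul_diag_mx !mxE B0 mul0r.
have rowZE r k : B r 0 = 0 -> row r (Z *m col' 0 B) 0 k = B r (lift 0 k).
  by move=> B0; rewrite mxE mul_diag_mx !mxE B0 eqxx mul1r.
have B00 := rowZ r0 n0.
have B10 : B r1 0 = 0 by apply: rowZ; apply: contraNneq n01 => ->; rewrite sub0mx.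
have full r k : B r 0 = 0 -> B r (lift 0 k) != 0.
  move=> B0; have E : rvsupp (row r B) = ~: [set 0].
    apply/eqP; rewrite eqEcard cardsC1 card_ord Bc andbT; apply/subsetP => i.
    by rewrite !inE mxE; apply: contraNneq => ->; rewrite B0.
  by have /setP/(_ (lift 0 k)) := E; rewrite !inE mxE.
have [b [d bd]] : exists b d, B r0 (lift 0 b) * B r1 (lift 0 d) != B r0 (lift 0 d) * B r1 (lift 0 b).
  have c0 : (0 < c)%N by lia. pose b := Ordinal c0.
  exists b; apply/existsP; rewrite -negb_forall; apply: contraNN n01 => /forallP H.
  apply/sub_rVP; exists (B r1 (lift 0 b) / B r0 (lift 0 b)); apply/rowP => d.
  rewrite [RHS]mxE !rowZE //; have /eqP Hd := H d.
  apply: (mulfI (full r0 b B00)); rewrite Hd mulrA mulrCA divff ?full // mulr1.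
  by rewrite mulrC.
have bnd : b != d by apply: contraNneq bd => ->.
have [a [ab ad]] : exists a, a != b /\ a != d.
  have : (0 < #|~: [set b; d]|)%N.
    by rewrite cardsCs setCK card_ord cards2 bnd; lia.
  by case/card_gt0P => a; rewrite !inE negb_or => /andP[ab ad]; exists a.
(* The points omitting [b] and [d] are told apart by the products of coordinate 0 with [d] and [b],
   which vanish on [E2]. The two points of [E2] are told apart by the products of [a] with [b] and
   [d], through the minor [bd]. *)
pose E1 : 'M[K]_(2, c.+1) := \matrix_r e (lift 0 (if r == 0 then b else d)).
pose E2 := col_mx (row r0 B) (row r1 B).
exists (2 + (1 + 1))%N, (col_mx E1 E2); split.
  move=> r; case: (split_ordP r) => k ->; rewrite ?rowKu ?rowKd ?rowK.
    by case: (eP (lift 0 (if k == 0 then b else d))).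
  by case: (split_ordP k) => l ->; rewrite ?rowKu ?rowKd ord1 row_id.
rewrite pairmx_col_mx -[X in (X <= _)%N]/(2 + 2)%N.
pose p1 (r : 'I_2) := p (if r == 0 then d else b).
apply: leq_trans (rank_col_mx_ge (p := p1) _ _); last first.
  apply/matrixP => r k; rewrite mxE pE [RHS]mxE.
  by case: (split_ordP r) => l ->; rewrite ?col_mxEu ?col_mxEd !mxE ?B00 ?B10 mul0r.
apply: leq_add.
  apply: (rank_diagonal_minor (p := id)) => r k; rewrite mxE pE !mxE mulf_eq0 negb_or !eE.
  rewrite (inj_eq lift_inj); case: r => [[|[|]]] // ?; case: k => [[|[|]]] // ?; rewrite -!val_eqE /=.
  - by rewrite eqxx.
  - by rewrite eqxx.
  - by rewrite val_eqE eq_sym bnd.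
rewrite /E2 pairmx_col_mx.
have lab : lift 0 a != lift 0 b by rewrite (inj_eq lift_inj).
have lad : lift 0 a != lift 0 d by rewrite (inj_eq lift_inj).
have [k kE] := pairmx_col K lab; have [l lE] := pairmx_col K lad.
suff /eqP-> : row_free (col_mx (pairmx (row r0 B)) (pairmx (row r1 B))) by [].
apply: row_free_col_mx.
  rewrite /row_free rank_rV; apply/eqP; rewrite (_ : _ != 0) //.
  apply/eqP => /rowP/(_ k); rewrite kE !mxE; apply/eqP.
  by rewrite mulf_neq0 ?full.
apply/negP => /sub_rVP[x /rowP E]; case/eqP: bd.
have Ek := E k; rewrite [RHS]mxE !kE !mxE in Ek.
have El := E l; rewrite [RHS]mxE !lE !mxE in El.
apply: (mulfI (mulf_neq0 (full r0 a B00) (full r1 a B10))).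
transitivity ((B r0 (lift 0 a) * B r0 (lift 0 b)) * (B r1 (lift 0 a) * B r1 (lift 0 d))).
  by ring.
rewrite Ek; transitivity ((x * (B r1 (lift 0 a) * B r1 (lift 0 d))) * (B r1 (lift 0 a) * B r1 (lift 0 b))).
  by ring.
by rewrite -El; ring.
Qed.

Lemma many_conditions k : (k <= 3)%N -> (k < c)%N ->
  (forall u, Yu u -> #|rvsupp u| != 1%N) ->
  (forall s, (2 <= s <= c)%N -> all_supports s \/ forall u, Yu u -> #|rvsupp u| != s) ->
  covered k.+1.
Proof.
move=> k3 kc no1 alt.
have weaken k1 k2 : (k1 <= k2)%N -> covered k2 -> covered k1.
  by move=> k12 [t [E [YE rE]]]; exists t, E; split=> //; apply: leq_trans rE.
have supp0 r : (0 < #|rvsupp (row r B)|)%N.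
  rewrite lt0n; apply/negP => /eqP/cards0_eq E.
  have Br : row r B = 0.
    by apply/rowP => i; have /setP/(_ i) := E; rewrite !inE => /negbFE/eqP ->; rewrite mxE.
  have := congr1 (row r) (mulmxV uB); rewrite row_mul Br mul0mx row1.
  by move/rowP/(_ r); rewrite !mxE !eqxx => /esym/eqP; rewrite oner_eq0.
have suppc r : (#|rvsupp (row r B)| <= c.+1)%N by rewrite -[X in (_ <= X)%N]card_ord max_card.
case: (classic (exists s, (2 <= s <= c)%N /\ all_supports s)) => [|nos]; last first.
  (* No support size from 1 to [c] occurs, so every frame point has all coordinates nonzero. *)
  apply: (weaken _ c) => //; apply: full_supports => r i.
  have E : #|rvsupp (row r B)| = c.+1.
    apply/eqP; rewrite eqn_leq suppc /= ltnNge; apply/negP => le.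
    have s2 : (2 <= #|rvsupp (row r B)| <= c)%N.
      by have := no1 _ (YB r); have := supp0 r; rewrite le; case: #|_| => [|[]].
    by case: (alt _ s2) => [H|/(_ _ (YB r))]; [case: nos; eexists; split; [apply: s2 |] | rewrite eqxx].
  have /setP/(_ i) : rvsupp (row r B) = setT by apply/eqP; rewrite eqEcard subsetT cardsT card_ord E /=.
  by rewrite !inE mxE.
case/classical_least => s [/andP[s2 sc] sY] mins.
case: (ltnP s c) => [lt|cs].
  by apply: (weaken _ 4) => //; apply: (short_supports (s := s)) => //; rewrite s2.
have {cs sc} Es : s = c by apply/eqP; rewrite eqn_leq sc.
rewrite Es in sY s2 mins; case: (ltnP k 3) => k3'.
  by apply: (weaken _ 3) => //; apply: cosingleton_supports.
(* Here [k = 3], so three conditions are not enough. By minimality of [s = c], every frame point has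
   at least [c] nonzero coordinates. *)
have c4 : (4 <= c)%N by apply: leq_trans kc.
apply: (weaken _ 4) => //; apply: near_full_supports => // r; rewrite leqNgt; apply/negP => lt.
have s2' : (2 <= #|rvsupp (row r B)| <= c)%N.
  by rewrite (ltnW lt) andbT; have := no1 _ (YB r); have := supp0 r; case: #|_| => [|[]].
case: (alt _ s2') => [H|/(_ _ (YB r))]; last by rewrite eqxx.
exact: (mins _ lt).
Qed.
End Configuration.
End ManyConditions.

(** * Uniform behaviour of the faces, and bounds on the number of quadrics *)

Section Supports.
Variable K : closedFieldType.
Notation mxpoly s m := (polyfun (@mxcoord K s m)).
Notation mxgen s m := (generically (@mxcoord K s m)).

Lemma set_param t s (T : {set 'I_t}) : #|T| = s ->
  exists2 f : 'I_s -> 'I_t, injective f & forall i, i \in T <-> exists j, i = f j.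
Proof.
move=> eT; exists (fun j => enum_val (cast_ord (esym eT) j)).
  by move=> i j /enum_val_inj /cast_ord_inj.
move=> i; split=> [iT|[j ->]]; last exact: enum_valP.
by exists (cast_ord eT (enum_rank_in iT i)); rewrite cast_ordK enum_rankK_in.
Qed.

Lemma generically_rowsub m s t (X : 'rV[K]_m -> Prop) (f : 'I_s -> 'I_t) P :
  (exists x, X x) -> injective f -> mxgen s m (rows_in X) P ->
  mxgen t m (rows_in X) (fun A => P (rowsub f A)).
Proof.
move=> [x0 Xx0] finj [g [xg [z Xz gz] gP]]; exists (fun A => g (rowsub f A)); split.
- apply: polyfun_mxcomp xg; exact: (polymap_mxsub _ _ (@polymap_id _ _ _)).
- exists (\matrix_i if [pick j | f j == i] is Some j then row j z else x0).
    by move=> i; rewrite rowK; case: pickP => [j _|].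
  rewrite (_ : rowsub f _ = z) //; apply/row_matrixP => j; rewrite row_rowsub rowK.
  by case: pickP => [l /eqP/finj -> //|/(_ j)]; rewrite eqxx.
by move=> A XA gA; apply: gP => // j; rewrite row_rowsub.
Qed.

Lemma mulmx_rowsub1 s t (f : 'I_s -> 'I_t) (b : 'rV[K]_s) : injective f ->
  (forall j, (b *m rowsub f 1%:M) 0 (f j) = b 0 j) /\
  (forall i, ~ (exists j, i = f j) -> (b *m rowsub f 1%:M) 0 i = 0).
Proof.
move=> finj; split=> [j|i ni]; rewrite mxE.
  rewrite (bigD1 j) //= big1 ?addr0 => [|l lj]; first by rewrite !mxE eqxx mulr1.
  by rewrite !mxE (inj_eq finj) (negPf lj) mulr0.
apply: big1 => j _; rewrite !mxE; case: eqP => [E|_]; last by rewrite mulr0.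
by case: ni; exists j.
Qed.

(** The dichotomy is applied to [s] points before they are placed among the [t] rows. Every choice
    of [s] rows ranges over the same set of tuples from [X], so the same alternative holds
    generically for all [T] of size [s]. *)
Lemma generically_supports m s t (X Yo : 'rV[K]_m -> Prop) :
  irreducible_set (@mxcoord K 1 m) X -> definable (@mxcoord K 1 m) Yo ->
  mxgen t m (rows_in X) (fun A =>
    (forall T : {set 'I_t}, #|T| = s -> exists u, Yo (u *m A) /\ rvsupp u = T) \/
    (forall u, Yo (u *m A) -> #|rvsupp u| != s)).
Proof.
move=> irrX dYo.
have irr r : irreducible_set (@mxcoord K r m) (rows_in X).
  exact: (irreducible_rows (S := fun=> X) (fun _ => irrX)).
have all_gen P : mxgen s m (rows_in X) P -> mxgen t m (rows_in X)
    (fun A => forall T : {set 'I_t}, #|T| = s -> exists2 f : 'I_s -> 'I_t,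
      injective f /\ (forall i, i \in T <-> exists j, i = f j) & P (rowsub f A)).
  move=> gP; apply: (generically_forall (irr t)) => T.
  have [eT|nT] := eqVneq #|T| s; last by apply: (generically_true (irr t)) => A _ /eqP; rewrite (negPf nT).
  have [f finj fT] := set_param eT.
  apply: (generically_imp (generically_rowsub irrX.1 finj gP)) => A _ PA _.
  by exists f.
case: (definable_dichotomy (irr s) (definable_in_open_span s dYo)) => /all_gen H;
  apply: (generically_imp H) => A _ HA; [left=> T eT | right=> u Yu].
  have [f [finj fT] [b [b0 Yb]]] := HA T eT.
  have [bf bn] := mulmx_rowsub1 b finj.
  exists (b *m rowsub f 1%:M); split; first by rewrite -mulmxA mul_rowsub_mx mul1mx.
  apply/setP => i; rewrite inE; apply/idP/idP.
    by apply: contraNT => /negP niT; rewrite bn // => /fT.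
  by case/fT => j ->; rewrite bf.
apply/eqP => eT; have [f [finj fT] nspan] := HA _ eT; apply: nspan.
exists (\row_j u 0 (f j)); split.
  move=> j; rewrite mxE; have : f j \in rvsupp u by apply/fT; exists j.
  by rewrite inE.
have [bf bn] := mulmx_rowsub1 (\row_j u 0 (f j)) finj.
suff Eu : (\row_j u 0 (f j)) *m rowsub f 1%:M = u.
  by rewrite -[A in rowsub f A]mul1mx -mul_rowsub_mx mulmxA Eu.
apply/rowP => i; case: (classic (exists j, i = f j)) => [[j ->]|ni].
  by rewrite bf mxE.
rewrite bn //; apply/esym/eqP/negP => /negP ui; apply: ni; apply/fT.
by rewrite inE.
Qed.

Lemma monomial_quad m (k : 'X_{1..m}) : mdeg k = 2%N ->
  exists Q : 'M[K]_m, forall x : 'rV_m, \prod_i x 0 i ^+ k i = quad Q x.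
Proof.
move=> k2; have [i ki] : exists i, k i != 0%N.
  apply/existsP; rewrite -negb_forall; apply/negP => /forallP k0.
  have k00 : k = 0%MM by apply/mnmP => i; rewrite mnm0E; apply/eqP.
  by rewrite k00 mdeg0 in k2.
have Ek : (k - U_(i) + U_(i))%MM = k by rewrite submK // lep1mP.
have /mdeg1P[j /eqP Ej] : mdeg (k - U_(i))%MM == 1%N.
  by have := mdegD (k - U_(i))%MM U_(i)%MM; rewrite Ek k2 mdeg1 addn1 => -[<-].
exists (delta_mx j i) => x; rewrite -mevalX -Ek Ej mpolyXD mevalM !mevalXU.
rewrite /quad mxE (bigD1 i) //= big1 ?addr0 => [|l li].
  rewrite mxE (bigD1 j) //= big1 ?addr0 => [|l lj]; first by rewrite !mxE !eqxx mulr1.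
  by rewrite !mxE (negPf lj) mulr0.
rewrite [X in X * _]mxE big1 ?mul0r // => n _.
by rewrite !mxE (negPf li) andbF mulr0.
Qed.

Lemma dhomog_quad m (p : {mpoly K[m]}) : p \is 2.-homog ->
  exists Q : 'M_m, forall x : 'rV_m, p.@[fun i => x 0 i] = quad Q x.
Proof.
move/dhomogP => p2.
suff H (r : seq 'X_{1..m}) : {subset r <= msupp p} -> exists Q : 'M_m, forall x : 'rV_m,
    \sum_(k <- r) p@_k * \prod_i x 0 i ^+ k i = quad Q x.
  by have [Q EQ] := H (msupp p) (fun _ => id); exists Q => x; rewrite mevalE.
elim: r => [_|k r IH rp].
  by exists 0 => x; rewrite big_nil /quad mulmx0 mul0mx mxE.
have [Q EQ] := IH (fun l lr => rp l (mem_behead (s := k :: r) lr)).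
have [R ER] := monomial_quad (p2 k (rp k (mem_head _ _))).
exists (p@_k *: R + Q) => x; rewrite big_cons EQ ER /quad mulmxDr mulmxDl.
by rewrite -scalemxAr -scalemxAl [RHS]mxE [in RHS]mxE.
Qed.

(** The classical bound in codimension [c]: a tuple of general points of [X] and an empty set of
    further points. *)
Lemma quads_bound_dim c d m b (X : 'rV[K]_m -> Prop) (M0 : 'M_(m, d)) (q : 'I_b -> 'M[K]_m) :
  (c + d = m)%N -> (0 < d)%N -> variety X -> spanning X ->
  dense X (fun x => x *m M0) -> (forall l x, X x -> quad (q l) x = 0) ->
  (forall a : 'rV_b, (forall w, quad (\sum_l a 0 l *: q l) w = 0) -> a = 0) ->
  (b <= 'C(c.+1, 2))%N.
Proof.
move=> cd d0 vX spX dM0 Xq inj.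
have [A XA Aq] := generically_ex (generically_quads_injective cd d0 vX spX dM0 Xq inj).
have qE l (r : 'I_0) : quad (q l) (row r (0 : 'M_(0, c.+1)) *m A) = 0 by case: r.
have := quads_bound Aq (fun l i => Xq l _ (XA i)) qE.
by rewrite (flatmx0 (pairmx _)) mxrank0 addn0.
Qed.

(** The form [p] vanishes on [Y] but not on [X], so it keeps the vertices, general points of [X],
    off [Y]; this excludes supports of size 1. *)
Lemma distinct_components_bound c d m b k (X Y : 'rV[K]_m -> Prop)
    (M1 M2 : 'M_(m, d)) (q : 'I_b -> 'M[K]_m) (p : {mpoly K[m]}) :
  (k <= 3)%N -> (k < c)%N ->
  (c + d = m)%N -> (0 < d)%N ->
  variety X -> spanning X -> dense X (fun x => x *m M1) ->
  variety Y -> spanning Y -> dense Y (fun x => x *m M2) ->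
  homogeneous p -> (forall y, Y y -> p.@[fun i => y 0 i] = 0) ->
  meets X (fun x => p.@[fun i => x 0 i]) ->
  (forall l x, X x -> quad (q l) x = 0) -> (forall l y, Y y -> quad (q l) y = 0) ->
  (forall a : 'rV_b, (forall w, quad (\sum_l a 0 l *: q l) w = 0) -> a = 0) ->
  (b + k.+1 <= 'C(c.+1, 2))%N.
Proof.
move=> k3 kc cd d0 vX spX dX vY spY dY [e pe] pY pX Xq Yq inj.
have [Yo [dYo YoY gYo]] := variety_model vY.
have irrX := variety_irreducible vX.
have irr := irreducible_rows (S := fun _ : 'I_c.+1 => X) (fun _ => irrX).
have g1 := generically_quads_injective cd d0 vX spX dX Xq inj.
have g2 := generically_transfer_back cd d0 vX spX dX (definable_has_frame _ dYo)
  (@has_frame_invariant _ _ _ Yo) (generically_has_frame cd d0 vY spY dY dYo gYo).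
have g3 : mxgen c.+1 m (rows_in X) (fun A => forall r, p.@[fun i => row r A 0 i] != 0).
  apply: (generically_forall irr) => r.
  exists (fun A => p.@[fun i => row r A 0 i]); split=> //.
    by apply: (polyfun_mxcomp _ (polyfun_rvmeval p)); apply: polymap_row; apply: polymap_id.
  by case: pX => x Xx px; exists (\matrix_i x) => [i|]; rewrite rowK.
have g4 := generically_forall irr (fun s : 'I_c.+1 => generically_supports s c.+1 irrX dYo).
have [A XA [[Aq [B [uB YB]]] [Ap As]]] := generically_ex (generically_and irr
  (generically_and irr g1 g2) (generically_and irr g3 g4)).
pose Yu (u : 'rV_c.+1) := Yo (u *m A).
have YB' r : Yu (row r B) by rewrite /Yu -row_mul.
have no1 u : Yu u -> #|rvsupp u| != 1%N.
  move=> Yuu; apply/negP => /cards1P[i Ei].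
  have Eu : u = u 0 i *: delta_mx 0 i.
    apply/rowP => j; rewrite !mxE; have /setP/(_ j) := Ei; rewrite !inE.
    have [->|ji] := eqVneq j i; first by rewrite !eqxx mulr1.
    by move/negbFE/eqP=> ->; rewrite andbF mulr0.
  have ui : u 0 i != 0 by have /setP/(_ i) := Ei; rewrite !inE eqxx.
  have : u 0 i ^+ e * p.@[fun j => row i A 0 j] = 0.
    rewrite -dhomog_meval // -[RHS](pY _ (YoY _ Yuu)) Eu -scalemxAl -rowE.
    by apply: meval_eq => j; rewrite !mxE !eqxx mulr1.
  by apply/eqP; rewrite mulf_neq0 ?expf_neq0.
have alt s : (2 <= s <= c)%N -> (forall T : {set 'I_c.+1}, #|T| = s ->
    exists u, Yu u /\ rvsupp u = T) \/ forall u, Yu u -> #|rvsupp u| != s.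
  by move=> /andP[s2 sc]; apply: (As (Ordinal (sc : (s < c.+1)%N))).
have [t [E [YE rE]]] := many_conditions uB YB' k3 kc no1 alt.
apply: leq_trans (quads_bound Aq (fun l i => Xq l _ (XA i)) (fun l r => Yq l _ (YoY _ (YE r)))).
by rewrite leq_add2l.
Qed.
End Supports.

(** * Application to the base locus *)

Section ProjectiveVarieties.
Variable K : closedFieldType.

Lemma dim_ge_extend m (Z Y : pset K m) n :
  dim_ge Z n -> proj_irreducible Y -> psubset Z Y -> ~ psubset Y Z -> dim_ge Y n.+1.
Proof.
case=> C [irrC ltC subC] irrY ZY nYZ.
exists (fun i => if (i <= n)%N then C i else Y); split.
- by move=> i _; case: ifP => [/irrC|].
- move=> i; rewrite ltnS => le_in; rewrite le_in; case: ifP => [|/negbT].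
    exact: ltC.
  rewrite -ltnNge ltnS => ni; have -> : i = n by apply/eqP; rewrite eqn_leq le_in.
  by split=> [v /subC/ZY|YC] //; apply: nYZ => v /YC/subC.
by rewrite ltnn.
Qed.

Lemma quadrics_as_matrices m b (X : pset K m) (qs : 'I_b -> {mpoly K[m]}) :
  (forall l, quadrics_on X (qs l)) -> lin_indep qs ->
  exists q : 'I_b -> 'M[K]_m,
    (forall l (x : 'rV_m), (qs l).@[fun i => x 0 i] = quad (q l) x) /\
    (forall a : 'rV_b, (forall w, quad (\sum_l a 0 l *: q l) w = 0) -> a = 0).
Proof.
move=> Xqs ind.
have [q Eq] := fin_all_exists (fun l => dhomog_quad (proj1 (Xqs l))).
exists q; split=> // a a0; apply/rowP => l; rewrite mxE; apply: (ind (a 0)).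
apply/eqP/negP => /negP/mpoly_neq0_meval[t]; rewrite raddf_sum -[X in _ != X](a0 t) quad_sum.
by case/eqP; apply: eq_bigr => j _; rewrite /= mevalZ Eq.
Qed.

Lemma quadrics_vanish_Qlocus m (X Y : pset K m) p (x : 'rV_m) :
  quadrics_on X p -> psubset Y (Qlocus X) -> rvset Y x -> p.@[fun i => x 0 i] = 0.
Proof. by move=> Xp YQ /YQ[_]; apply. Qed.

End ProjectiveVarieties.

Theorem theorem1p5 (K : closedFieldType) (charK0 : [pchar K] =i pred0)
    (n c k : nat) (X : pset K (n + c).+1) :
  (k <= 3)%N -> (k.+1 <= c)%N ->
  proj_irreducible X -> dim_eq X n -> proj_nondegenerate X ->
  a2_eq X ('C(c.+1, 2) - k)%N ->
  irr_component (Qlocus X) X /\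
  (forall Y : pset K (n + c).+1,
     irr_component (Qlocus X) Y -> proj_nondegenerate Y -> dim_ge Y n ->
     pseteq Y X).
Proof.
move=> k3 kc irrX [dimX _] ndX [[qs [Xqs ind]] _].
have cX : zclosed X by case: irrX.
have [q [Eq inj]] := quadrics_as_matrices Xqs ind.
have vX := proj_irreducible_variety irrX.
have spX := proj_nondegenerate_spanning cX ndX.
have XQ : psubset X (Qlocus X).
  move=> v Xv; split; first by case: cX => S [_ XS]; case/XS: Xv.
  by move=> p [_]; apply.
have Yq Y l x : psubset Y (Qlocus X) -> rvset Y x -> quad (q l) x = 0.
  by move=> YQ Yx; rewrite -Eq; apply: (quadrics_vanish_Qlocus (Xqs l) YQ).
have compX : irr_component (Qlocus X) X.
  split=> // Y irrY XY YQ v; split; last exact: XY.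
  apply: NNPP; case/(imply_to_and (Y v)) => Yv nXv.
  have dimY : dim_ge Y n.+1 by apply: (dim_ge_extend dimX irrY XY) => /(_ v Yv).
  have [M dM] := dim_ge_dense dimY.
  have spY : spanning (rvset Y) by move=> w /spX[x Xx xw]; exists x => //; apply: XY.
  (* A larger [Y] in the base locus has codimension at most [c - 1], so it lies on at most
     ['C(c, 2) = 'C(c + 1, 2) - c] independent quadrics, fewer than the given ones because
     [k < c]. *)
  have cn : (c.-1 + n.+2 = (n + c).+1)%N by lia.
  have := quads_bound_dim cn isT (proj_irreducible_variety irrY) spY dM
    (fun l x => Yq Y l x YQ) inj.
  by have := binS c 1; rewrite bin1 (ltn_predK kc) => ->; lia.
split=> // Y [irrY YQ _] ndY dimY.
have cY : zclosed Y by case: irrY.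
case: (classic (psubset X Y)) => [XY|nXY]; first by case: compX => _ _; apply.
have [p [ph pY pX]] := zclosed_separate cY cX nXY.
have [M1 dM1] := dim_ge_dense dimX; have [M2 dM2] := dim_ge_dense dimY.
have cn : (c + n.+1 = (n + c).+1)%N by lia.
have spY := proj_nondegenerate_spanning cY ndY.
have := distinct_components_bound k3 kc cn isT vX spX dM1
  (proj_irreducible_variety irrY) spY dM2 ph pY pX
  (fun l x => Yq X l x XQ) (fun l x => Yq Y l x YQ) inj.
by have := binS c 1; rewrite bin1; lia.
Qed.
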